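(* Let $d,n\ge 1$, let $0<\mu\le L$, and let $f_1,\dots,f_n,g:\mathbb{R}^d\to\mathbb{R}$ be differentiable functions that are all $L$-smooth and $\mu$-strongly convex. Let $x^\star$ be the unique minimizer over $\mathbb{R}^d$ of $\frac1n\sum_{i=1}^n f_i+g$. Consider the LoCoDL algorithm (defined in the context) with parameters $\gamma,\chi,\rho>0$ and $p\in(0,1]$, with compressors $(\mathcal{C}_i^t)_{i\in[n],\,t\ge 0}$ that all belong to $\mathbb{U}(\omega)$ for some $\omega\ge 0$, such that $\mathcal{C}_i^t$ and $\mathcal{C}_{i'}^{t'}$ are independent whenever $t\ne t'$ (for the same $t$ they need not be independent). Let $\omega_{\mathrm{av}}\ge 0$ be such that for every $t\ge 0$ and all $x_1,\dots,x_n\in\mathbb{R}^d$, $$\mathbb{E}\left[\left\|\frac1n\sum_{i=1}^n\big(\mathcal{C}_i^t(x_i)-x_i\big)\right\|^2\right]\le\frac{\omega_{\mathrm{av}}}{n}\sum_{i=1}^n\|x_i\|^2 .$$ Suppose that $0<\gamma<\frac2L$ and $2\rho-\rho^2(1+\omega_{\mathrm{av}})-\chi\ge 0$. For every $t\ge 0$, define $$\Psi^t:=\frac1\gamma\left(\sum_{i=1}^n\|x_i^t-x^\star\|^2+n\|y^t-x^\star\|^2\right)+\frac{\gamma(1+2\omega)}{p^2\chi}\left(\sum_{i=1}^n\|u_i^t-u_i^\star\|^2+n\|v^t-v^\star\|^2\right),$$ where $v^\star:=\nabla g(x^\star)$ and $u_i^\star:=\nabla f_i(x^\star)$. Then for every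 $t\ge 0$, $$\mathbb{E}[\Psi^t]\le\tau^t\,\Psi^0,\qquad\text{where}\qquad \tau:=\max\left((1-\gamma\mu)^2,\,(1-\gamma L)^2,\,1-\frac{p^2\chi}{1+2\omega}\right)<1 .$$ In addition, almost surely, for every $i\in[n]$, $(x_i^t)_{t\in\mathbb{N}}$ and $(y^t)_{t\in\mathbb{N}}$ converge to $x^\star$, $(u_i^t)_{t\in\mathbb{N}}$ converges to $u_i^\star$, and $(v^t)_{t\in\mathbb{N}}$ converges to $v^\star$.
   Context: Notation: $[n]=\{1,\dots,n\}$; $\|\cdot\|$ is the Euclidean norm. A differentiable $f:\mathbb{R}^d\to\mathbb{R}$ is $L$-smooth if $\|\nabla f(x)-\nabla f(y)\|\le L\|x-y\|$ for all $x,y$; it is $\mu$-strongly convex if $f-\frac\mu2\|\cdot\|^2$ is convex. Compressors: for $\omega\ge 0$, $\mathbb{U}(\omega)$ is the set of random operators $\mathcal{C}:\mathbb{R}^d\to\mathbb{R}^d$ such that for every $x\in\mathbb{R}^d$, $\mathbb{E}[\mathcal{C}(x)]=x$ and $\mathbb{E}[\|\mathcal{C}(x)-x\|^2]\le\omega\|x\|^2$. LoCoDL algorithm. Input: stepsizes $\gamma>0$, $\chi>0$, $\rho>0$; probability $p\in(0,1]$; variance factor $\omega\ge 0$; (deterministic) initial vectors $x_1^0,\dots,x_n^0,y^0\in\mathbb{R}^d$ and $u_1^0,\dots,u_n^0,v^0\in\mathbb{R}^d$ with $\frac1n\sum_{i=1}^n u_i^0+v^0=0$. For $t=0,1,2,\dots$: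 - For each $i\in[n]$, $\hat x_i^t:=x_i^t-\gamma\nabla f_i(x_i^t)+\gamma u_i^t$; and $\hat y^t:=y^t-\gamma\nabla g(y^t)+\gamma v^t$. - Draw a coin $\theta^t\in\{0,1\}$, common to all $i$, with $\mathrm{Prob}(\theta^t=1)=p$. The coin flips are independent of each other and of the compressors. - If $\theta^t=1$: $d_i^t:=\mathcal{C}_i^t(\hat x_i^t-\hat y^t)$ for each $i\in[n]$, $\bar d^t:=\frac1{2n}\sum_{j=1}^n d_j^t$, and $x_i^{t+1}:=(1-\rho)\hat x_i^t+\rho(\hat y^t+\bar d^t)$, $u_i^{t+1}:=u_i^t+\frac{p\chi}{\gamma(1+2\omega)}(\bar d^t-d_i^t)$ for each $i\in[n]$, $y^{t+1}:=\hat y^t+\rho\bar d^t$, $v^{t+1}:=v^t+\frac{p\chi}{\gamma(1+2\omega)}\bar d^t$. - If $\theta^t=0$: $x_i^{t+1}:=\hat x_i^t$, $u_i^{t+1}:=u_i^t$ for each $i\in[n]$, $y^{t+1}:=\hat y^t$, $v^{t+1}:=v^t$. The randomness of the compressors and coin at iteration $t$ is independent of the past (of all variables with superscript at most $t$ generated before iteration $t$'s draws). Expectations are over all coins and compressors. *)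

(* Defs.v *)
From HB Require Import structures.
From mathcomp Require Import all_boot all_order all_algebra finmap.
From mathcomp Require Import all_classical all_reals all_analysis.

Set Implicit Arguments.
Unset Strict Implicit.
Unset Printing Implicit Defensive.

Import Order.TTheory GRing.Theory Num.Theory.
Import numFieldNormedType.Exports.

Local Open Scope classical_set_scope.
Local Open Scope ring_scope.

Section euclidean.
Context {R : realType} {d : nat}.
Implicit Types (f : 'rV[R]_d -> R) (x y : 'rV[R]_d).

(* The library norm [`|x|] on ['rV[R]_d] is the sup norm; it induces the same
   topology as [enorm], so [differentiable] and convergence are unaffected. *)
Definition enorm x : R := Num.sqrt (\sum_(j < d) x 0 j ^+ 2).

(* Meaningful where [f] is differentiable. *)
Definition grad f x : 'rV[R]_d := \row_(j < d) 'D_(delta_mx 0 j) f x.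

Definition smooth (L : R) f : Prop :=
  (forall x, differentiable f x) /\
  (forall x y, enorm (grad f x - grad f y) <= L * enorm (x - y)).

Definition strongly_convex (mu : R) f : Prop :=
  convex_function (setT : set (convex_lmodType 'rV[R]_d))
    (fun x => f x - mu / 2 * enorm x ^+ 2).

Definition unique_minimizer f x : Prop :=
  (forall y, f x <= f y) /\ (forall z, (forall y, f z <= f y) -> z = x).

End euclidean.

Definition borel_rV (R : realType) (d : nat) :=
  g_sigma_algebraType (@open 'rV[R]_d).

Section probability.
Context {R : realType} {disp : measure_display} {Omega : measurableType disp}.
Variable P : probability Omega R.

Definition is_sub_sigma_algebra (G : set (set Omega)) : Prop :=
  sigma_algebra setT G /\ G `<=` measurable.

Definition sigma_rv {disp' : measure_display} {T : measurableType disp'}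
    (X : Omega -> T) : set (set Omega) :=
  preimage_set_system setT X measurable.

Definition mutually_independent {I : choiceType}
    (F : I -> set (set Omega)) : Prop :=
  forall (J : {fset I}) (A : I -> set Omega),
    (forall i, i \in J -> F i (A i)) ->
    P (\bigcap_(i in [set` J]) A i) = (\prod_(i <- J) P (A i))%E.

(* A random operator with randomness [G]: jointly measurable in the outcome,
   relative to [G], and the argument. Asking only that [C w x] be
   [G]-measurable for each fixed [x] would not be enough to evaluate [C] at a
   random point independent of [G]: the value could be non-measurable, or
   biased with respect to the fixed-argument expectations. *)
Definition random_operator (d : nat) (G : set (set Omega))
    (C : Omega -> 'rV[R]_d -> 'rV[R]_d) : Prop :=
  measurable_fun setT
    (fun z : g_sigma_algebraType G * borel_rV R d =>
       (C z.1 z.2 : borel_rV R d)).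

(* Membership in the class U(omega). The coordinatewise equalities force
   integrability, since the integral of a function whose positive and negative
   parts both have infinite integral is [-oo]. *)
Definition unbiased_compressor (d : nat) (omega : R)
    (C : Omega -> 'rV[R]_d -> 'rV[R]_d) : Prop :=
  forall x : 'rV[R]_d,
    (forall j, 'E_P[fun w => C w x ord0 j] = (x ord0 j)%:E)%E /\
    ('E_P[fun w => (enorm (C w x - x) ^+ 2)%R]
       <= (omega * enorm x ^+ 2)%:E)%E.

End probability.

Section locodl.
Context {R : realType} {d n : nat}.

Record state := State {
  st_x : 'I_n -> 'rV[R]_d;
  st_u : 'I_n -> 'rV[R]_d;
  st_y : 'rV[R]_d;
  st_v : 'rV[R]_d
}.

Variables (f : 'I_n -> 'rV[R]_d -> R) (g : 'rV[R]_d -> R).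
Variables (gamma chi rho p omega : R).

Definition locodl_step (comp : 'I_n -> 'rV[R]_d -> 'rV[R]_d) (coin : bool)
    (s : state) : state :=
  let xh i := st_x s i - gamma *: grad (f i) (st_x s i) + gamma *: st_u s i in
  let yh := st_y s - gamma *: grad g (st_y s) + gamma *: st_v s in
  let delta i := comp i (xh i - yh) in
  let dbar := (2 * n%:R)^-1 *: \sum_(j < n) delta j in
  let eta := p * chi / (gamma * (1 + 2 * omega)) in
  if coin then
    State (fun i => (1 - rho) *: xh i + rho *: (yh + dbar))
          (fun i => st_u s i + eta *: (dbar - delta i))
          (yh + rho *: dbar)
          (st_v s + eta *: dbar)
  else State xh (st_u s) yh (st_v s).

Fixpoint locodl {Omega : Type}
    (C : 'I_n -> nat -> Omega -> 'rV[R]_d -> 'rV[R]_d)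
    (theta : nat -> Omega -> bool) (s0 : state) (t : nat) (w : Omega) : state :=
  if t is t'.+1 then
    locodl_step (fun i => C i t' w) (theta t' w) (locodl C theta s0 t' w)
  else s0.

Definition lyapunov (xs : 'rV[R]_d) (s : state) : R :=
  gamma^-1 * (\sum_(i < n) enorm (st_x s i - xs) ^+ 2
              + n%:R * enorm (st_y s - xs) ^+ 2)
  + gamma * (1 + 2 * omega) / (p ^+ 2 * chi)
    * (\sum_(i < n) enorm (st_u s i - grad (f i) xs) ^+ 2
       + n%:R * enorm (st_v s - grad g xs) ^+ 2).

End locodl.

Arguments state : clear implicits.

(* Main.v *)
Require Import Defs.
From HB Require Import structures.
From mathcomp Require Import all_boot all_order all_algebra finmap.
From mathcomp Require Import all_classical all_reals all_analysis.
From mathcomp Require Import ring lra measurable_realfun.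

Set Implicit Arguments.
Unset Strict Implicit.
Unset Printing Implicit Defensive.

Import Order.TTheory GRing.Theory Num.Theory.
Import numFieldNormedType.Exports.

Local Open Scope classical_set_scope.
Local Open Scope ring_scope.

(** One iteration multiplies the expected Lyapunov function by at most the
rate; this is an algebraic fact about a single step, to which independence is
then applied.

For the step, let the gaps be the differences between the local predictions
and the shared one, D the sum of their squares, and V ([disagreement]) the
squared distance of all the predictions, the shared one counting n times, to
their consensus average; D <= 2 V. When the coin is 1, the compression noise
has mean zero and only its second moments, at most proportional to D, survive
in expectation. By the condition on rho and chi, the primal part of the
Lyapunov function then decreases by at least chi V / gamma
([expected_step_true_le]), while its dual part changes by a cross term and
increases by a multiple of V. The weights are such that, averaged over the
coin, this increase cancels the decrease exactly ([coin_average_le]). The cross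
term that is left pairs the dual errors e with the errors a of the predictions,
and it completes squares: |a|^2 / gamma - 2 <e, a> is
|a - gamma e|^2 / gamma - gamma |e|^2, where a - gamma e is the difference of
two gradient steps. Gradient steps are contractions because the gradient of a
smooth strongly convex function is cocoercive ([gradient_step_contraction]),
and - gamma |e|^2 gives the contraction of the dual part. Two facts about the
optimum and the iterates enter here: the optimal gradients have zero weighted
sum ([mean_gradient_minimizer]), and so do the dual variables along the
iterations ([dual_sum_step]).

As for the randomness, the state at iteration t is measurable with respect to
the sigma-algebra generated by the earlier coins and compressors, which is
independent of the coin and the compressors of iteration t, by a pi-system
argument ([joint_sigma_indep]). The joint law of past and fresh randomness is
thus a product measure, and Tonelli's theorem allows the step inequality to be
used with the state frozen ([integral_diag_indep_le]), first for the
compressors, then for the coin. Induction on t gives the geometric bound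
([expected_Psi_le]).

Finally, geometric decay makes the expectations summable, so the Lyapunov
values are almost surely summable and tend to 0; each error is bounded by a
constant times the Lyapunov function. *)

(** * Euclidean geometry of row vectors *)

Lemma le_of_eq (R : numDomainType) (x y : R) : x = y -> x <= y.
Proof. by move->. Qed.

Section dot.
Context {R : realType} {d : nat}.
Implicit Types (x y z : 'rV[R]_d) (a : R).

Definition dot x y : R := \sum_(j < d) x 0 j * y 0 j.

Lemma dotC x y : dot x y = dot y x.
Proof. by apply: eq_bigr => j _; rewrite mulrC. Qed.

Lemma dotDl x y z : dot (x + y) z = dot x z + dot y z.
Proof. by rewrite -big_split; apply: eq_bigr => j _; rewrite mxE mulrDl. Qed.

Lemma dotZl a x y : dot (a *: x) y = a * dot x y.
Proof. by rewrite mulr_sumr; apply: eq_bigr => j _; rewrite mxE mulrA. Qed.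

Lemma dotNl x y : dot (- x) y = - dot x y.
Proof. by rewrite -scaleN1r dotZl mulN1r. Qed.

Lemma dotDr x y z : dot x (y + z) = dot x y + dot x z.
Proof. by rewrite dotC dotDl !(dotC x). Qed.

Lemma dotZr a x y : dot x (a *: y) = a * dot x y.
Proof. by rewrite dotC dotZl dotC. Qed.

Lemma dotNr x y : dot x (- y) = - dot x y.
Proof. by rewrite dotC dotNl dotC. Qed.

Lemma dot0l x : dot 0 x = 0.
Proof. by rewrite -(scale0r 0) dotZl mul0r. Qed.

Lemma dot_suml (I : finType) (u : I -> 'rV[R]_d) x :
  dot (\sum_i u i) x = \sum_i dot (u i) x.
Proof.
by apply: (big_morph (dot^~ x)) => [y z|]; [exact: dotDl|exact: dot0l].
Qed.

Lemma dot_sumr (I : finType) (u : I -> 'rV[R]_d) x :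
  dot x (\sum_i u i) = \sum_i dot x (u i).
Proof. by rewrite dotC dot_suml; apply: eq_bigr => i _; rewrite dotC. Qed.

Definition dotE := (dotDl, dotDr, dotNl, dotNr, dotZl, dotZr).

Lemma dot_ge0 x : 0 <= dot x x.
Proof. by apply: sumr_ge0 => j _; rewrite -expr2 sqr_ge0. Qed.

Lemma dot_eq0 x : dot x x = 0 -> x = 0.
Proof.
move=> /eqP; rewrite psumr_eq0 => [/allP h|j _]; last by rewrite -expr2 sqr_ge0.
apply/rowP => j; rewrite mxE; apply/eqP.
by have := h j (mem_index_enum _); rewrite mulf_eq0 orbb.
Qed.

Lemma sqr_enorm x : enorm x ^+ 2 = dot x x.
Proof.
rewrite sqr_sqrtr; first by apply: eq_bigr => j _; rewrite expr2.
by apply: sumr_ge0 => j _; rewrite sqr_ge0.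
Qed.

Lemma enorm_ge0 x : 0 <= enorm x. Proof. exact: sqrtr_ge0. Qed.

Lemma enormZ a x : enorm (a *: x) = `|a| * enorm x.
Proof.
apply/eqP; rewrite -(@eqrXn2 _ 2) ?mulr_ge0 ?enorm_ge0//.
by rewrite exprMn !sqr_enorm !dotE real_normK ?num_real// mulrA -expr2.
Qed.

Lemma sqr_coord_le x j : (x 0 j) ^+ 2 <= dot x x.
Proof.
rewrite /dot (bigD1 j)//= -expr2 lerDl sumr_ge0// => i _.
by rewrite -expr2 sqr_ge0.
Qed.

(** The square of |y|^2 x - <x, y> y is nonnegative. *)
Lemma cauchy_schwarz x y : dot x y <= enorm x * enorm y.
Proof.
have [->|y0] := eqVneq y 0.
  by rewrite dotC dot0l mulr_ge0// enorm_ge0.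
have yy : 0 < dot y y.
  by rewrite lt_neqAle dot_ge0 andbT eq_sym; apply: contra_neq y0; exact: dot_eq0.
apply: le_trans (ler_norm _) _; rewrite -ler_sqr ?nnegrE ?mulr_ge0 ?enorm_ge0//.
rewrite exprMn !sqr_enorm real_normK ?num_real//.
have := dot_ge0 (dot y y *: x - dot x y *: y).
rewrite !dotE (dotC y x).
set a := dot x x; set b := dot y y; set c := dot x y => h.
rewrite -(ler_pM2l yy) -/b -subr_ge0.
by move: h; congr (_ <= _); ring.
Qed.

End dot.

(** * Smooth strongly convex functions *)

Section calculus.
Context {R : realType} {d : nat}.
Implicit Types (f : 'rV[R]_d -> R) (x y z e : 'rV[R]_d).

Lemma derive_grad f y e : differentiable f y -> 'D_e f y = dot (grad f y) e.
Proof.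
move=> df; rewrite deriveE// {1}(row_sum_delta e) linear_sum/=.
by apply: eq_bigr => j _; rewrite linearZ/= mxE deriveE// mulrC.
Qed.

Lemma is_derive_line f y e (t : R) : differentiable f (y + t *: e) ->
  is_derive t 1 (fun s : R => f (y + s *: e)) (dot (grad f (y + t *: e)) e).
Proof.
move=> df; have dfe : derivable f (y + t *: e) e by exact: diff_derivable.
have E : (fun h : R => h^-1 *: (f (y + (h *: 1 + t) *: e) - f (y + t *: e)))
   = (fun h : R => h^-1 *: (f (h *: e + (y + t *: e)) - f (y + t *: e))).
  apply/funext => h; congr (_ *: (f _ - _)).
  by rewrite scalerDl addrCA [_ *: 1]mulr1.
apply: DeriveDef; first by rewrite /derivable /= E.
by rewrite -derive_grad// /derive /= E.
Qed.

(** The quadratic remainder vanishes in the limit of the difference quotient at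
0+. This turns an inequality along a segment into one about the gradient. *)
Lemma derive_le f y e (c K : R) : derivable f y e ->
  (forall t, 0 < t -> t <= 1 -> f (y + t *: e) - f y <= t * c + t ^+ 2 * K) ->
  'D_e f y <= c.
Proof.
move=> df h.
have Dr : h^-1 *: (f (h *: e + y) - f y) @[h --> 0^'+] --> 'D_e f y.
  exact: cvg_dnbhs_at_right df.
have Br : c + h * K @[h --> (0 : R)^'+] --> c.
  rewrite -[X in _ --> X]addr0 -[X in _ --> _ + X](mul0r K).
  apply: cvgD; first exact: cvg_cst.
  by apply: cvgMr_tmp; apply: cvg_at_right_filter; exact: cvg_id.
apply: (ler_cvg_to Dr Br); near=> t.
have t0 : 0 < t by near: t; exact: nbhs_right_gt.
have t1 : t <= 1 by near: t; exact: nbhs_right_le.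
rewrite [h in h <= _]mulrC ler_pdivrMr// [in X in X - _]addrC.
by apply: le_trans (h _ t0 t1) _; apply: le_of_eq; ring.
Unshelve. all: by end_near. Qed.

(** The derivative of t |-> f (y + t e) - t <grad f y, e> - L t^2 |e|^2 / 2,
where e = z - y, is nonpositive for t > 0 by the Cauchy-Schwarz inequality and
the Lipschitz bound; the mean value theorem compares the values at 0 and 1. *)
Lemma descent (L : R) f y z : smooth L f ->
  f z <= f y + dot (grad f y) (z - y) + L / 2 * dot (z - y) (z - y).
Proof.
move=> [df lip]; set e := z - y.
pose phi := fun t : R => f (y + t *: e) - t * dot (grad f y) e - L / 2 * t ^+ 2 * dot e e.
pose dphi := fun t : R => dot (grad f (y + t *: e)) e - dot (grad f y) e - L * t * dot e e.
have phiE (t : R) : is_derive t 1 phi (dphi t).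
  rewrite /phi; have h1 := is_derive_line (df (y + t *: e)).
  apply: is_derive_eq.
  by rewrite /dphi /GRing.scale/=; field.
have phic : {within `[0, 1], continuous phi}.
  apply: continuous_subspaceT => t.
  apply/differentiable_continuous/derivable1_diffP; exact: (@ex_derive _ _ _ _ _ _ _ (phiE t)).
have [t] := MVT ltr01 (fun t _ => phiE t) phic.
rewrite in_itv/= => /andP[t0 t1].
rewrite subr0 mulr1 {1 2}/phi !scale1r !scale0r !addr0 /e subrKC -/e => h.
have : dphi t <= 0.
  rewrite /dphi.
  have := cauchy_schwarz (grad f (y + t *: e) - grad f y) e.
  rewrite dotDl dotNl => /le_trans -/(_ (L * t * dot e e)) h'.
  rewrite subr_le0; apply: h'.
  have := ler_wpM2r (enorm_ge0 e) (lip (y + t *: e) y).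
  move=> /le_trans; apply.
  rewrite addrAC subrr add0r -!mulrA; apply: le_of_eq; congr (_ * _).
  by rewrite enormZ (gtr0_norm t0) -mulrA -expr2 sqr_enorm.
rewrite -h; rewrite !mul1r !mul0r expr1n mulr1 !subr0 expr0n/= mulr0 mul0r subr0.
by move=> {h}; rewrite lerBlDr add0r => ?; lra.
Qed.

(** Along the segment from y to z, convexity bounds the increment of f by a
linear term plus a quadratic one, so [derive_le] applies. *)
Lemma strongly_convex_lb (mu : R) f y z :
  differentiable f y -> strongly_convex mu f ->
  f y + dot (grad f y) (z - y) + mu / 2 * dot (z - y) (z - y) <= f z.
Proof.
move=> df cf; set e := z - y.
have ze : z = y + e by rewrite /e subrKC.
clearbody e; subst z.
suff : 'D_e f y <= f (y + e) - f y - mu / 2 * dot e e.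
  by rewrite derive_grad//; lra.
apply: (@derive_le _ _ _ _ (mu / 2 * dot e e)); first exact: diff_derivable.
move=> t t0 t1.
have t01 : 0 <= t <= 1 by rewrite ltW.
have := cf (Itv01 (ltW t0) t1) (y + e) y (mem_set I) (mem_set I).
rewrite /conv/= /conv/= /unstable.onem/=.
have -> : t *: (y + e) + (1 - t) *: y = y + t *: e.
  by rewrite scalerDr scalerBl scale1r addrAC addrCA subrr addr0.
rewrite !sqr_enorm !dotE /GRing.scale/= (dotC e y).
move: (dot y y) (dot y e) (dot e e) (f y) (f (y + e)) (f (y + t *: e)) => a b c u v w.
rewrite -subr_ge0 -[_ - _ <= _]subr_ge0; congr (_ <= _); ring.
Qed.

(** The Baillon-Haddad inequality for f - mu |.|^2 / 2, whose gradient increment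
is q. Evaluating at y + t q the lower bound based at x and the upper bound
based at y, and symmetrically at x - t q, gives
2 t |q|^2 - (L - mu) t^2 |q|^2 <= <q, x - y> for every t. If L > mu, the best
choice is t = 1 / (L - mu); if L = mu, letting t grow forces q = 0. *)
Lemma cocoercive (mu L : R) f x y : mu <= L -> smooth L f -> strongly_convex mu f ->
  let q := grad f x - grad f y - mu *: (x - y) in
  dot q q <= (L - mu) * dot q (x - y).
Proof.
move=> muL fL fmu /=; set q := grad f x - _ - _.
have h t : 2 * t * dot q q - (L - mu) * t ^+ 2 * dot q q <= dot q (x - y).
  have gx : grad f x = grad f y + q + mu *: (x - y).
    by rewrite /q -addrA subrK subrKC.
  have [df _] := fL.
  have lx := strongly_convex_lb (y + t *: q) (df x) fmu.
  have uy := descent y (y + t *: q) fL.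
  have ly := strongly_convex_lb (x - t *: q) (df y) fmu.
  have ux := descent x (x - t *: q) fL.
  have := lerD (le_trans lx uy) (le_trans ly ux).
  clear lx uy ly ux.
  have -> : y + t *: q - x = t *: q - (x - y) by rewrite opprB addrCA addrA.
  have -> : y + t *: q - y = t *: q by rewrite addrC addKr.
  have -> : x - t *: q - y = (x - y) - t *: q by rewrite addrAC.
  have -> : x - t *: q - x = - (t *: q) by rewrite addrC addKr.
  rewrite gx; clear gx; clearbody q; move: (x - y) => e; clear df.
  rewrite !dotE (dotC e q).
  move: (f x) (f y) (dot (grad f y) q) (dot (grad f y) e)
    (dot q q) (dot q e) (dot e e) =>
    a b c k v w z H.
  rewrite -subr_ge0; set u := (X in 0 <= X).
  rewrite -subr_ge0 in H; apply: le_trans H _.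
  by apply: le_of_eq; rewrite /u; field.
have qq := dot_ge0 q.
have [M0|M0] := ltP 0 (L - mu).
  have := h (L - mu)^-1.
  set A := dot q q; set M := L - mu => h'.
  rewrite mulrC -ler_pdivrMr//; apply: le_trans h'.
  apply: le_of_eq; field; exact: lt0r_neq0.
have M00 : L - mu = 0 by apply/eqP; rewrite eq_le M0 subr_ge0.
rewrite M00 mul0r leNgt; apply/negP => qq0.
(* With L = mu the bound is 2 t |q|^2 <= <q, x - y>, which this t violates. *)
have := h ((1 + `|dot q (x - y)|) / dot q q).
rewrite M00 !mul0r subr0 -mulrA divfK ?gt_eqF//.
have := ler_norm (dot q (x - y)); have := normr_ge0 (dot q (x - y)).
lra.
Qed.

(** With q as in [cocoercive], w = (1 - gamma mu) (x - y) - gamma q, and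
cocoercivity bounds |w|^2 by an affine function of <q, x - y>. This inner
product lies between 0 and (L - mu) |x - y|^2, and at these two ends the bound
is (1 - gamma mu)^2 |x - y|^2 and (1 - gamma L)^2 |x - y|^2. *)
Lemma gradient_step_contraction (mu L gamma : R) f x y :
  mu <= L -> 0 < gamma -> smooth L f -> strongly_convex mu f ->
  let w := (x - gamma *: grad f x) - (y - gamma *: grad f y) in
  dot w w <= Num.max ((1 - gamma * mu) ^+ 2) ((1 - gamma * L) ^+ 2) * dot (x - y) (x - y).
Proof.
move=> muL g0 fL fmu /=; set w := x - _ - _.
have := cocoercive x y muL fL fmu => /=; set q := grad f x - _ - _ => qq.
have -> : w = (1 - gamma * mu) *: (x - y) - gamma *: q.
  rewrite /w /q; apply/rowP => j; rewrite !mxE; ring.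
have sE : dot q (x - y) <= (L - mu) * dot (x - y) (x - y).
  have := cauchy_schwarz (grad f x - grad f y) (x - y).
  move/le_trans => /(_ _ (ler_wpM2r (enorm_ge0 _) (fL.2 x y))).
  rewrite -mulrA -expr2 sqr_enorm /q => h.
  by rewrite [X in X <= _]dotDl dotNl dotZl mulrBl lerD2r.
clear w; clearbody q; move: (x - y) qq sE => e qq sE.
have s0 : 0 <= dot q e.
  rewrite leNgt; apply/negP => s0.
  have q0 : q = 0.
    apply/dot_eq0/eqP; rewrite eq_le dot_ge0 andbT (le_trans qq)//.
    by rewrite mulr_ge0_le0 ?subr_ge0// ltW.
  by move: s0; rewrite q0 dot0l ltxx.
rewrite !dotE (dotC e q).
move: (dot_ge0 e) qq s0 sE.
move: (dot q q) (dot q e) (dot e e) => B s E E0 Bs s0 sE.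
have gB := ler_wpM2l (sqr_ge0 gamma) Bs.
apply: (@le_trans _ _ ((1 - gamma * mu) ^+ 2 * E
    + gamma * s * (gamma * (L + mu) - 2))).
  by move: gB; rewrite -subr_ge0 => gB; rewrite -subr_ge0 (le_trans gB)//; apply: le_of_eq; ring.
have [c2|c2] := leP (gamma * (L + mu)) 2.
  apply: (@le_trans _ _ ((1 - gamma * mu) ^+ 2 * E)).
    by rewrite gerDl mulr_ge0_le0 ?mulr_ge0 ?subr_le0// ltW.
  by rewrite ler_wpM2r// le_max lexx.
apply: (@le_trans _ _ ((1 - gamma * L) ^+ 2 * E)); last first.
  by rewrite ler_wpM2r// le_max lexx orbT.
have c0 : 0 <= gamma * (gamma * (L + mu) - 2) by rewrite mulr_ge0 ?subr_ge0 ?ltW.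
have := ler_wpM2l c0 sE; rewrite -subr_ge0 => h.
by rewrite -subr_ge0 (le_trans h)//; apply: le_of_eq; ring.
Qed.

(** If the sum G of the gradients were not zero, the step - G / (2 n L) would
decrease the objective, by the descent inequality for each of the functions. *)
Lemma mean_gradient_minimizer n (L : R) (f : 'I_n -> 'rV[R]_d -> R) g xs :
  0 < L -> (forall i, smooth L (f i)) -> smooth L g -> (0 < n)%N ->
  (forall x, n%:R^-1 * (\sum_(i < n) f i xs) + g xs
             <= n%:R^-1 * (\sum_(i < n) f i x) + g x) ->
  \sum_(i < n) grad (f i) xs + n%:R *: grad g xs = 0.
Proof.
move=> L0 fL gL n0 xsmin; set G := (X in X = 0).
have n0' : 0 < n%:R :> R by rewrite ltr0n.
apply: dot_eq0; apply/eqP; rewrite eq_le dot_ge0 andbT.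
pose t := (2 * n%:R * L)^-1 : R.
have t0 : 0 < t by rewrite invr_gt0 !mulr_gt0.
have h (f' : 'rV[R]_d -> R) : smooth L f' ->
    f' (xs - t *: G) <= f' xs - t * dot (grad f' xs) G + L / 2 * t ^+ 2 * dot G G.
  move=> f'L; have := descent xs (xs - t *: G) f'L.
  have -> : xs - t *: G - xs = - (t *: G) by rewrite addrC addKr.
  clearbody G.
  rewrite !dotE; congr (_ <= _); ring.
have hs : \sum_(i < n) f i (xs - t *: G) <= \sum_(i < n)
     (f i xs - t * dot (grad (f i) xs) G + L / 2 * t ^+ 2 * dot G G).
  by apply: ler_sum => i _; exact: h.
have hg := h _ gL.
move: hs; rewrite !big_split/= sumr_const card_ord sumrN -mulr_sumr -dot_suml.
have -> : \sum_(i < n) grad (f i) xs = G - n%:R *: grad g xs by rewrite addrK.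
have := xsmin (xs - t *: G).
rewrite -(ler_pM2l n0') !mulrDr !mulrA divff ?gt_eqF// !mul1r.
have := ler_wpM2l (ltW n0') hg.
have tE : n%:R * L * t = 2^-1 by rewrite /t; field; rewrite ?gt_eqF.
clearbody G t; clear hg h; rewrite !dotE.
move: (dot G G) (dot (grad g xs) G) => A B.
move: (\sum_(i < n) _) (\sum_(i < n) _) (g _) (g _) => a b u v.
rewrite -[_ *+ n]mulr_natl => h1 h2 h3.
have {h1 h2 h3} : 0 <= (n%:R * L * t) * t * A - t * A.
  rewrite -subr_ge0 in h1; rewrite -subr_ge0 in h2; rewrite -subr_ge0 in h3.
  have := addr_ge0 (addr_ge0 h1 h2) h3.
  by congr (_ <= _); field.
rewrite tE => h.
by rewrite -(pmulr_rle0 _ t0); lra.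
Qed.
End calculus.

(** * Algebra of one iteration *)

Section one_step.
Context {R : realType} {d n : nat}.
Hypothesis n_gt0 : (0 < n)%N.
Variables (f : 'I_n -> 'rV[R]_d -> R) (g : 'rV[R]_d -> R) (xs : 'rV[R]_d).
Variables (gamma chi rho p omega : R).
Hypotheses (gamma_gt0 : 0 < gamma) (chi_gt0 : 0 < chi) (p_gt0 : 0 < p)
  (omega_ge0 : 0 <= omega).
Implicit Types s : state R d n.

Let c := gamma * (1 + 2 * omega) / (p ^+ 2 * chi).
Let eta := p * chi / (gamma * (1 + 2 * omega)).

(** The prediction made from a primal variable x with dual variable u. *)
Definition forward (h : 'rV[R]_d -> R) x u := x - gamma *: grad h x + gamma *: u.
Definition xhat s i := forward (f i) (st_x s i) (st_u s i).
Definition yhat s := forward g (st_y s) (st_v s).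
Definition gap s i := xhat s i - yhat s.
(** The consensus average of the predictions, yhat s counting n times, is
yhat s + half_gap s. *)
Definition half_gap s := (2 * n%:R)^-1 *: \sum_(i < n) gap s i.
Definition uerr s i := st_u s i - grad (f i) xs.
Definition verr s := st_v s - grad g xs.

(** Squared distance of the predictions to their consensus average, yhat s
counting n times. *)
Definition disagreement s : R := \sum_(i < n) dot (gap s i) (gap s i)
   - 2 * n%:R * dot (half_gap s) (half_gap s).

(** Inner product of the dual errors with the mean dual increments, up to the
factor eta. *)
Definition coupling s : R := \sum_(i < n) dot (uerr s i) (half_gap s - gap s i)
   + n%:R * dot (verr s) (half_gap s).

(** Bounds the Lyapunov function after a step with coin b, in expectation over
the compressors. *)
Definition step_bound (b : bool) s : R :=
  gamma^-1 * (\sum_(i < n) dot (xhat s i - xs) (xhat s i - xs)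
     + n%:R * dot (yhat s - xs) (yhat s - xs))
  + c * (\sum_(i < n) dot (uerr s i) (uerr s i) + n%:R * dot (verr s) (verr s))
  + (if b then - (chi / gamma) * disagreement s
       + c * (2 * eta * coupling s + eta ^+ 2 * (1 + 2 * omega) * disagreement s)
     else 0).

Let nR_gt0 : 0 < n%:R :> R. Proof. by rewrite ltr0n. Qed.
Let om_gt0 : 0 < 1 + 2 * omega :> R. Proof. by have := omega_ge0; lra. Qed.
Let gi_gt0 : 0 < gamma^-1. Proof. by rewrite invr_gt0. Qed.
Let c_gt0 : 0 < c. Proof. by rewrite divr_gt0 ?mulr_gt0// exprn_gt0. Qed.

(** For dl = gap s, the squared primal errors of the predictions are the case
t = 1, and those after a step with coin 1 are the case t = 1 - rho. *)
Lemma sqr_consensus (dl : 'I_n -> 'rV[R]_d) m h (t : R) :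
  \sum_i dl i = (2 * n%:R) *: m ->
  \sum_i dot (t *: dl i + h) (t *: dl i + h) + n%:R * dot h h =
  t ^+ 2 * \sum_i dot (dl i) (dl i) + 4 * n%:R * t * dot m h + 2 * n%:R * dot h h.
Proof.
move=> dlm.
under eq_bigr => i _.
  rewrite (_ : dot _ _ = t ^+ 2 * dot (dl i) (dl i) + dot (dl i) ((2 * t) *: h)
    + dot h h); last first.
    by rewrite !dotE (dotC h); ring.
  over.
rewrite !big_split/= -dot_suml -mulr_sumr dlm sumr_const card_ord !dotE.
by rewrite -[_ *+ n]mulr_natl; ring.
Qed.

(** The squared dual errors after a step with coin 1 have this form, where e is
the family of compressed gaps. *)
Lemma sqr_dual (u e : 'I_n -> 'rV[R]_d) v m (t : R) :
  \sum_i e i = (2 * n%:R) *: m ->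
  \sum_i dot (u i + t *: (m - e i)) (u i + t *: (m - e i))
    + n%:R * dot (v + t *: m) (v + t *: m) =
  \sum_i dot (u i) (u i) + n%:R * dot v v
  + 2 * t * (\sum_i dot (u i) (m - e i) + n%:R * dot v m)
  + t ^+ 2 * (\sum_i dot (e i) (e i) - 2 * n%:R * dot m m).
Proof.
move=> em.
under eq_bigr => i _.
  rewrite (_ : dot _ _ = dot (u i) (u i) + 2 * t * dot (u i) (m - e i)
    + t ^+ 2 * dot (e i) (e i) + dot (e i) (- 2 * t ^+ 2 *: m) + t ^+ 2 * dot m m); last first.
    by rewrite !dotE (dotC (e i) (u i)) (dotC m (e i)) (dotC m (u i)); ring.
  over.
rewrite !big_split/= -dot_suml -!mulr_sumr em sumr_const card_ord !dotE (dotC m v).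
by rewrite -[_ *+ n]mulr_natl; ring.
Qed.

Lemma sum_gap s : \sum_i gap s i = (2 * n%:R) *: half_gap s.
Proof. by rewrite /half_gap scalerA divff ?scale1r// mulf_neq0// gt_eqF. Qed.

Lemma lyapunov_dot s : lyapunov f g gamma chi p omega xs s =
  gamma^-1 * (\sum_(i < n) dot (st_x s i - xs) (st_x s i - xs)
     + n%:R * dot (st_y s - xs) (st_y s - xs))
  + c * (\sum_(i < n) dot (uerr s i) (uerr s i) + n%:R * dot (verr s) (verr s)).
Proof.
rewrite /lyapunov -/c !sqr_enorm.
by congr (_ * (_ + _) + _ * (_ + _)); apply: eq_bigr => i _; rewrite sqr_enorm.
Qed.

Lemma lyapunov_step_false comp s :
  lyapunov f g gamma chi p omega xs (locodl_step f g gamma chi rho p omega comp false s) =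
  step_bound false s.
Proof. by rewrite lyapunov_dot /step_bound addr0. Qed.

Definition noise (comp : 'I_n -> 'rV[R]_d -> 'rV[R]_d) s i := comp i (gap s i) - gap s i.

(** Coefficient of the noise in the first-order part of the Lyapunov function
after a step with coin 1. *)
Definition noise_direction s i : 'rV[R]_d :=
  (2 * rho / gamma) *: (half_gap s + (yhat s - xs))
  + (2 * c * eta) *: ((2 * n%:R)^-1 *: (\sum_j uerr s j + n%:R *: verr s) - uerr s i
     + eta *: (gap s i - half_gap s)).

(** The difference of the two sides is the sum of the |gap s i - 2 half_gap s|^2.
It follows that the variance bounds, which are relative to the squared gaps,
can be charged to the disagreement. *)
Lemma half_gap_sqr_le s :
  4 * n%:R * dot (half_gap s) (half_gap s) <= \sum_i dot (gap s i) (gap s i).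
Proof.
have h : 0 <= \sum_i dot (gap s i - 2 *: half_gap s) (gap s i - 2 *: half_gap s).
  by apply: sumr_ge0 => i _; exact: dot_ge0.
rewrite -subr_ge0; apply: le_trans h _; apply: le_of_eq.
under eq_bigr => i _.
  rewrite (_ : dot _ _ = dot (gap s i) (gap s i) + dot (gap s i) (- 4 *: half_gap s)
     + 4 * dot (half_gap s) (half_gap s)); last first.
    by move: (gap s i) (half_gap s) => a b; rewrite !dotE (dotC b); ring.
  over.
rewrite !big_split/= -dot_suml sum_gap sumr_const card_ord.
by move: (half_gap s) => m; rewrite !dotE -[_ *+ n]mulr_natl; ring.
Qed.

(** An identity, except that - 2 n c eta^2 |z|^2 is discarded, where z is half
of the average noise. That term comes from the dual errors, and the variance
assumptions give no lower bound for its expectation. *)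
Lemma lyapunov_step_true_le comp s :
  lyapunov f g gamma chi p omega xs (locodl_step f g gamma chi rho p omega comp true s) <=
  gamma^-1 * (\sum_(i < n) dot (xhat s i - xs) (xhat s i - xs)
     + n%:R * dot (yhat s - xs) (yhat s - xs))
  + c * (\sum_(i < n) dot (uerr s i) (uerr s i) + n%:R * dot (verr s) (verr s))
  - gamma^-1 * (2 * rho - rho ^+ 2) * disagreement s
  + c * (2 * eta * coupling s + eta ^+ 2 * disagreement s)
  + \sum_i dot (noise_direction s i) (noise comp s i)
  + n%:R * rho ^+ 2 / (2 * gamma) *
      dot (n%:R^-1 *: \sum_i noise comp s i) (n%:R^-1 *: \sum_i noise comp s i)
  + c * eta ^+ 2 * \sum_i dot (noise comp s i) (noise comp s i).
Proof.
pose z := (2 * n%:R)^-1 *: \sum_i noise comp s i.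
have n2 : 2 * n%:R != 0 :> R by rewrite mulf_neq0// gt_eqF.
have noise_sum : \sum_i noise comp s i = (2 * n%:R) *: z.
  by rewrite /z scalerA divff ?scale1r.
have compE i : comp i (gap s i) = gap s i + noise comp s i by rewrite /noise subrKC.
have comp_sum : \sum_i comp i (gap s i) = (2 * n%:R) *: (half_gap s + z).
  by rewrite scalerDr -sum_gap -noise_sum -big_split; apply: eq_bigr => i _.
have dbarE : (2 * n%:R)^-1 *: (\sum_i comp i (gap s i)) = half_gap s + z.
  by rewrite comp_sum scalerA mulVf ?scale1r.
rewrite lyapunov_dot /= -/c -/eta.
rewrite -!/(yhat s).
rewrite (_ : \sum_i dot (_ - xs) (_ - xs) = \sum_i
    dot ((1 - rho) *: gap s i + (yhat s - xs + rho *: (half_gap s + z)))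
        ((1 - rho) *: gap s i + (yhat s - xs + rho *: (half_gap s + z)))); last first.
  apply: eq_bigr => i _; rewrite -!/(xhat s _) dbarE.
  by rewrite (_ : _ - xs = (1 - rho) *: gap s i + (yhat s - xs + rho *: (half_gap s + z)))//
    /gap; apply/rowP => j; rewrite !mxE; ring.
rewrite dbarE (_ : yhat s + rho *: (half_gap s + z) - xs
   = yhat s - xs + rho *: (half_gap s + z)); last by rewrite addrAC.
rewrite (sqr_consensus _ _ (sum_gap s)).
rewrite (_ : \sum_i dot (uerr _ i) (uerr _ i) = \sum_i
    dot (uerr s i + eta *: (half_gap s + z - comp i (gap s i)))
        (uerr s i + eta *: (half_gap s + z - comp i (gap s i)))); last first.
  by apply: eq_bigr => i _; rewrite /uerr/= (addrAC (st_u s i)).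
rewrite (_ : verr _ = verr s + eta *: (half_gap s + z)); last first.
  by rewrite /verr/= (addrAC (st_v s)).
rewrite (sqr_dual _ _ _ comp_sum).
rewrite (_ : \sum_i dot (xhat s i - xs) (xhat s i - xs) = \sum_i
   dot (1 *: gap s i + (yhat s - xs)) (1 *: gap s i + (yhat s - xs))); last first.
  by apply: eq_bigr => i _; rewrite scale1r /gap addrA subrK.
rewrite (sqr_consensus _ _ (sum_gap s)).
rewrite (_ : n%:R^-1 *: _ = 2 *: z); last first.
  by rewrite noise_sum scalerA; congr (_ *: _); field; exact: lt0r_neq0.
rewrite /coupling /disagreement.
under [X in _ <= _ + X + _ + _]eq_bigr do rewrite /noise_direction.
under [X in _ + c * (_ + 2 * eta * (X + _) + _) <= _]eq_bigr do rewrite compE.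
under [X in _ + c * (_ + _ + _ * (X - _)) <= _]eq_bigr do rewrite compE.
clear comp_sum dbarE compE; clearbody z.
move: (sum_gap s) noise_sum.
move: (gap s) (half_gap s) (yhat s - xs) (uerr s) (verr s) (noise comp s) => dl m b u v xi dlm xiz.
have -> : \sum_i dot (u i) (m + z - (dl i + xi i)) =
    \sum_i dot (u i) (m - dl i) + dot (\sum_i u i) z - \sum_i dot (u i) (xi i).
  by rewrite dot_suml -big_split -sumrB/=; apply: eq_bigr => i _; rewrite !dotE; ring.
have -> : \sum_i dot (dl i + xi i) (dl i + xi i) =
    \sum_i dot (dl i) (dl i) + 2 * \sum_i dot (dl i) (xi i) + \sum_i dot (xi i) (xi i).
  rewrite mulr_sumr -!big_split/=; apply: eq_bigr => i _; rewrite !dotE (dotC (xi i) (dl i)); ring.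
have -> : \sum_i dot ((2 * rho / gamma) *: (m + b) + (2 * c * eta) *:
      ((2 * n%:R)^-1 *: (\sum_j u j + n%:R *: v) - u i + eta *: (dl i - m))) (xi i) =
    (2 * rho / gamma) * (2 * n%:R) * dot (m + b) z + 2 * c * eta * (dot (\sum_j u j + n%:R *: v) z
      - \sum_i dot (u i) (xi i) + eta * (\sum_i dot (dl i) (xi i) - 2 * n%:R * dot m z)).
  have sz k : dot k z = (2 * n%:R)^-1 * \sum_i dot k (xi i).
    by rewrite -dot_sumr xiz dotZr mulrA mulVf ?mul1r.
  rewrite !sz.
  rewrite (_ : \sum_i dot (_ + _) (xi i) = \sum_i ((2 * rho / gamma) * dot (m + b) (xi i)
    + 2 * c * eta * ((2 * n%:R)^-1 * dot (\sum_j u j + n%:R *: v) (xi i) - dot (u i) (xi i)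
      + eta * (dot (dl i) (xi i) - dot m (xi i))))); last first.
    by apply: eq_bigr => i _; move: (\sum_j u j) => U; rewrite !dotE; ring.
  rewrite big_split/= -!mulr_sumr big_split/= sumrB -!mulr_sumr sumrB.
  by field; rewrite !gt_eqF.
move: (\sum_i u i) => U; rewrite !dotE (dotC b m) (dotC z m) (dotC z b).
have := mulr_ge0 (mulr_ge0 (ltW c_gt0) (sqr_ge0 eta)) (mulr_ge0 (ltW nR_gt0) (dot_ge0 z)).
rewrite -subr_ge0 => h; rewrite -subr_ge0; apply: le_trans (mulr_ge0 (ler0n R 2) h) _.
by apply: le_of_eq; field; rewrite !gt_eqF.
Qed.

Lemma sqr_gap_le_disagreement s :
  \sum_i dot (gap s i) (gap s i) <= 2 * disagreement s.
Proof. by have := half_gap_sqr_le s; rewrite /disagreement; lra. Qed.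

Lemma disagreement_ge0 s : 0 <= disagreement s.
Proof.
have := sqr_gap_le_disagreement s.
have : 0 <= \sum_i dot (gap s i) (gap s i) by apply: sumr_ge0 => i _; exact: dot_ge0.
lra.
Qed.

(** The part of the bound in [lyapunov_step_true_le] that does not depend on the
noise. *)
Definition noiseless_value s : R :=
  gamma^-1 * (\sum_(i < n) dot (xhat s i - xs) (xhat s i - xs)
     + n%:R * dot (yhat s - xs) (yhat s - xs))
  + c * (\sum_(i < n) dot (uerr s i) (uerr s i) + n%:R * dot (verr s) (verr s))
  - gamma^-1 * (2 * rho - rho ^+ 2) * disagreement s
  + c * (2 * eta * coupling s + eta ^+ 2 * disagreement s).

(** The sum of the squared gaps is at most twice the disagreement, so that
replacing it by this multiple uses exactly the factors 1 + omega_av and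
1 + 2 omega; the condition on rho and chi does the rest. *)
Lemma noise_budget (omega_av : R) s :
  0 <= omega_av -> 0 <= 2 * rho - rho ^+ 2 * (1 + omega_av) - chi ->
  noiseless_value s
  + n%:R * rho ^+ 2 / (2 * gamma) * (omega_av / n%:R * \sum_i dot (gap s i) (gap s i))
  + c * eta ^+ 2 * (omega * \sum_i dot (gap s i) (gap s i)) <= step_bound true s.
Proof.
move=> oav0 rc; rewrite /noiseless_value /step_bound.
move: (disagreement_ge0 s) (sqr_gap_le_disagreement s).
move: (disagreement s) (\sum_i dot (gap s i) (gap s i)) => V D V0 DV.
move: (gamma^-1 * (\sum_i _ + _)) (c * (\sum_i _ + _)) (coupling s) => A U K.
have h1 := mulr_ge0 (mulr_ge0 (ltW gi_gt0) V0) rc.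
have k0 : 0 <= gamma^-1 * rho ^+ 2 * omega_av / 2 + c * eta ^+ 2 * omega.
  apply: addr_ge0; last by rewrite mulr_ge0// mulr_ge0 ?sqr_ge0 ?ltW.
  by rewrite divr_ge0// mulr_ge0// mulr_ge0 ?sqr_ge0 ?ltW.
have h2 := mulr_ge0 k0 (etrans (subr_ge0 _ _) DV).
rewrite -subr_ge0; apply: le_trans (addr_ge0 h1 h2) _.
by apply: le_of_eq; field; rewrite !gt_eqF.
Qed.

(** Here a = w + gamma e, where w is a difference of two gradient steps, so that
the left-hand side is |w|^2 / gamma + (c - gamma) |e|^2; and c - gamma is c
times the third term of the maximum. *)
Lemma forward_contraction (mu L : R) h x u : mu <= L -> smooth L h ->
    strongly_convex mu h ->
  let tau := Num.max (Num.max ((1 - gamma * mu) ^+ 2) ((1 - gamma * L) ^+ 2))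
                     (1 - p ^+ 2 * chi / (1 + 2 * omega)) in
  let a := forward h x u - xs in let e := u - grad h xs in
  gamma^-1 * dot a a - 2 * dot e a + c * dot e e <=
  tau * (gamma^-1 * dot (x - xs) (x - xs) + c * dot e e).
Proof.
move=> muL hL hmu /=; set tau := Num.max (Num.max _ _) _.
set w := x - gamma *: grad h x - (xs - gamma *: grad h xs).
have := gradient_step_contraction x xs muL gamma_gt0 hL hmu; rewrite -/w => hw.
have -> : forward h x u - xs = w + gamma *: (u - grad h xs).
  by apply/rowP => j; rewrite /forward /w !mxE; ring.
clearbody w; move: (u - grad h xs) (x - xs) hw => e k hw.
rewrite !dotE (dotC e w).
have tau1 : Num.max ((1 - gamma * mu) ^+ 2) ((1 - gamma * L) ^+ 2) <= tau.
  by rewrite /tau le_max lexx.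
have tau2 : 1 - p ^+ 2 * chi / (1 + 2 * omega) <= tau by rewrite /tau le_max lexx orbT.
have {}hw := le_trans hw (ler_wpM2r (dot_ge0 k) tau1).
have he := ler_wpM2r (mulr_ge0 (ltW c_gt0) (dot_ge0 e)) tau2.
have {}hw := ler_wpM2l (ltW gi_gt0) hw.
rewrite [X in _ <= X]mulrDr [X in _ <= X + _]mulrCA; apply: le_trans (lerD hw he).
by apply: le_of_eq; rewrite /c; field; rewrite !gt_eqF.
Qed.

(** Since p c eta = 1, the multiple of the disagreement that the dual part gains
on average is p chi / gamma, which the primal part loses. What remains is twice
the coupling; as the dual errors have zero weighted sum, it is a sum of cross
terms as in [forward_contraction], one for each function. *)
Lemma coin_average_le (mu L : R) s : mu <= L -> (forall i, smooth L (f i)) -> smooth L g ->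
    (forall i, strongly_convex mu (f i)) -> strongly_convex mu g ->
    \sum_i grad (f i) xs + n%:R *: grad g xs = 0 ->
    \sum_i st_u s i + n%:R *: st_v s = 0 ->
  let tau := Num.max (Num.max ((1 - gamma * mu) ^+ 2) ((1 - gamma * L) ^+ 2))
                     (1 - p ^+ 2 * chi / (1 + 2 * omega)) in
  p * step_bound true s + (1 - p) * step_bound false s
  <= tau * lyapunov f g gamma chi p omega xs s.
Proof.
move=> muL fL gL fmu gmu gradx dual /=; set tau := Num.max (Num.max _ _) _.
have err0 : \sum_i uerr s i + n%:R *: verr s = 0.
  by rewrite /uerr /verr sumrB scalerBr addrACA -opprD dual gradx subrr.
have kE : coupling s = - \sum_i dot (uerr s i) (xhat s i - xs)
    - n%:R * dot (verr s) (yhat s - xs).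
  rewrite /coupling.
  have -> : \sum_i dot (uerr s i) (half_gap s - gap s i) =
      dot (\sum_i uerr s i) (half_gap s + (yhat s - xs))
      - \sum_i dot (uerr s i) (xhat s i - xs).
    rewrite dot_suml -sumrB; apply: eq_bigr => i _.
    rewrite -(dotNr _ (xhat s i - xs)) -dotDr; congr dot.
    by rewrite /gap; apply/rowP => j; rewrite !mxE; ring.
  rewrite (_ : \sum_i uerr s i = - (n%:R *: verr s)); last first.
    by apply/eqP; rewrite -addr_eq0 err0.
  by move: (half_gap s) (yhat s - xs) (verr s) => m b v; rewrite !dotE; ring.
have fwd h x u := @forward_contraction mu L h x u muL.
rewrite lyapunov_dot /step_bound addr0 kE.
move: (disagreement s) => V.
have hf : \sum_i (gamma^-1 * dot (xhat s i - xs) (xhat s i - xs)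
     - 2 * dot (uerr s i) (xhat s i - xs) + c * dot (uerr s i) (uerr s i)) <=
   \sum_i tau * (gamma^-1 * dot (st_x s i - xs) (st_x s i - xs) + c * dot (uerr s i) (uerr s i)).
  by apply: ler_sum => i _; exact: fwd.
have hg := ler_wpM2l (ltW nR_gt0) (fwd _ (st_y s) (st_v s) gL gmu).
move: hf hg; rewrite -/tau -/(yhat s) -/(verr s) -mulr_sumr !big_split/= sumrN -!mulr_sumr.
move: (\sum_i _) (\sum_i _) (\sum_i _) (\sum_i _) => B D E F.
move=> h1 h2; rewrite -subr_ge0 in h1; rewrite -subr_ge0 in h2.
rewrite -subr_ge0; apply: le_trans (addr_ge0 h1 h2) _.
by apply: le_of_eq; rewrite /c /eta; field; rewrite !gt_eqF.
Qed.

(** Up to the factor eta, the dual increments of a step with coin 1 are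
dbar - delta i for each i and dbar with weight n, where dbar is the sum of the
delta i over 2 n. *)
Lemma dual_sum_step comp b s : \sum_i st_u s i + n%:R *: st_v s = 0 ->
  let s' := locodl_step f g gamma chi rho p omega comp b s in
  \sum_i st_u s' i + n%:R *: st_v s' = 0.
Proof.
case: b => //= dual.
rewrite big_split/= -scaler_sumr sumrB sumr_const card_ord.
set D := \sum_i comp i _.
rewrite [n%:R *: _]scalerDr addrACA dual add0r.
have swap k : n%:R *: (p * chi / (gamma * (1 + 2 * omega)) *: k)
    = p * chi / (gamma * (1 + 2 * omega)) *: (n%:R *: k) :> 'rV[R]_d.
  by rewrite !scalerA mulrC.
rewrite swap -scalerDr.
rewrite [X in _ *: X](_ : _ = 0) ?scaler0//.
rewrite -[_ *+ n]scaler_nat; clearbody D; apply/rowP => j; rewrite !mxE. field.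
by rewrite gt_eqF.
Qed.

Lemma lyapunov_ge0 s : 0 <= lyapunov f g gamma chi p omega xs s.
Proof.
rewrite lyapunov_dot.
have sum0 (v : 'I_n -> 'rV[R]_d) w : 0 <= \sum_i dot (v i) (v i) + n%:R * dot w w.
  by apply: addr_ge0; [apply: sumr_ge0 => i _; exact: dot_ge0|rewrite mulr_ge0 ?dot_ge0// ltW].
by apply: addr_ge0; apply: mulr_ge0; rewrite ?sum0// ltW.
Qed.
End one_step.

(** * Measurability of vectors and states *)

Section norms.
Context {R : realType} {d : nat}.
Implicit Types x y : 'rV[R]_d.

Lemma coord_le_norm x j : `|x 0 j| <= `|x|.
Proof.
rewrite [X in _ <= X]mx_normrE.
exact: (le_bigmax _ (fun i : 'I_1 * 'I_d => `|x i.1 i.2|) (0, j)).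
Qed.

Lemma norm_le_enorm x : `|x| <= enorm x.
Proof.
rewrite [X in X <= _]mx_normrE; apply: bigmax_le; first exact: enorm_ge0.
move=> [i j] _ /=; rewrite (ord1 i).
rewrite -ler_sqr ?nnegrE ?enorm_ge0// sqr_enorm real_normK ?num_real//.
exact: sqr_coord_le.
Qed.

Lemma enorm_le_norm x : enorm x <= Num.sqrt d%:R * `|x|.
Proof.
rewrite -ler_sqr ?nnegrE ?enorm_ge0 ?mulr_ge0 ?sqrtr_ge0//.
rewrite exprMn sqr_enorm sqr_sqrtr ?ler0n// /dot.
rewrite (_ : d%:R * _ = \sum_(j < d) `|x| ^+ 2); last first.
  by rewrite sumr_const card_ord mulr_natl.
apply: ler_sum => j _.
rewrite -expr2 -real_normK ?num_real// ler_sqr ?nnegrE//; exact: coord_le_norm.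
Qed.

Lemma grad_coord_continuous (L : R) f j : smooth L f ->
  continuous (fun x => grad f x 0 j).
Proof.
move=> [_ fL] x; apply/(@cvgrPdist_le _ _ _ (nbhs x)) => e e0.
(* A Lipschitz constant for the sup norm; adding 1 makes it positive. *)
pose K := `|L| * Num.sqrt d%:R + 1.
have K0 : 0 < K by rewrite ltr_wpDl// mulr_ge0 ?sqrtr_ge0.
near=> y.
have -> : grad f x 0 j - grad f y 0 j = (grad f x - grad f y) 0 j by rewrite !mxE.
apply: le_trans (coord_le_norm _ _) _; apply: le_trans (norm_le_enorm _) _.
apply: le_trans (fL _ _) _.
apply: (@le_trans _ _ (K * `|x - y|)).
  rewrite mulrDl mul1r; apply: (@le_trans _ _ (`|L| * Num.sqrt d%:R * `|x - y|)).
    apply: le_trans (ler_wpM2r (enorm_ge0 _) (ler_norm L)) _.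
    by rewrite -mulrA ler_wpM2l// enorm_le_norm.
  by rewrite lerDl.
rewrite mulrC -ler_pdivlMr//; near: y.
exact: (@cvgr_dist_le _ _ _ (nbhs x) _ id x (@cvg_id _ (nbhs x)) _ (divr_gt0 e0 K0)).
Unshelve. all: by end_near. Qed.
End norms.

Section borel_rV.
Context {R : realType} {d : nat} {disp : measure_display} {T : measurableType disp}.

Lemma measurable_continuous_rV (phi : 'rV[R]_d -> R) (F : T -> 'rV[R]_d) :
  continuous phi -> measurable_fun setT (F : T -> borel_rV R d) ->
  measurable_fun setT (phi \o F).
Proof.
move=> /continuousP cphi mF.
apply: (measurability _ (RGenOpens.measurableE R)) => _ [_ [a [b ->] <-]].
rewrite setTI comp_preimage.
have := mF measurableT (phi @^-1` `]a, b[); rewrite setTI; apply.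
by apply: sub_sigma_algebra; apply: cphi; exact: interval_open.
Qed.

(** An open set is the union of the boxes with rational centre and radius
1 / (m + 1) that it contains, and there are countably many such boxes. *)
Lemma measurable_rV_coord (F : T -> 'rV[R]_d) :
  (forall j, measurable_fun setT (fun z => F z 0 j)) <->
  measurable_fun setT (F : T -> borel_rV R d).
Proof.
split=> [mF|mF j]; last first.
  exact: (measurable_continuous_rV (@coord_continuous _ _ _ 0 j) mF).
apply: (@measurability _ _ T (borel_rV R d) setT F (@open 'rV[R]_d)) => // _ [U oU <-].
rewrite setTI.
pose box (q : 'rV[rat]_d * nat) : set 'rV[R]_d :=
  \bigcap_j [set x | `|ratr (q.1 0 j) - x 0 j| < q.2.+1%:R^-1].
pose Q := [set q | box q `<=` U].
have -> : F @^-1` U = \bigcup_q (if q \in Q then F @^-1` box q else set0).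
  apply/seteqP; split => [w Uw|w [q _]]; last first.
    by case: ifPn => //; rewrite inE => qQ /qQ.
  have /nbhs_ballP[e e0 eU] : nbhs (F w) U by exact: open_nbhs_nbhs.
  have [m me] : exists m : nat, m.+1%:R^-1 < e / 2.
    have [m _ /(_ m (leqnn m)) me] := near_infty_natSinv_lt (PosNum (divr_gt0 e0 (ltr0n R 2))).
    by exists m.
  have [q qF] : exists q : 'rV[rat]_d, forall j, `|ratr (q 0 j) - F w 0 j| < m.+1%:R^-1.
    have h j : exists r : rat, `|ratr r - F w 0 j| < m.+1%:R^-1.
      have [|r] := @rat_in_itvoo R (F w 0 j) (F w 0 j + m.+1%:R^-1).
        by rewrite ltrDl invr_gt0.
      rewrite in_itv/= => /andP[r1 r2]; exists r.
      by rewrite gtr0_norm ?subr_gt0// ltrBlDl.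
    have [r hr] := choice h.
    by exists (\row_j r j) => j; rewrite mxE.
  exists (q, m) => //; rewrite ifT; first by move=> j _; exact: qF.
  rewrite inE => x qx; apply: eU; split => // i j; rewrite (ord1 i).
  rewrite -ball_normE/=.
  have := qF j; have := qx j I; rewrite /= => h1 h2.
  rewrite (_ : F w 0 j - x 0 j = (ratr (q 0 j) - x 0 j) - (ratr (q 0 j) - F w 0 j)); last by ring.
  apply: le_lt_trans (ler_normB _ _) _.
  by rewrite [ltRHS](splitr e) ltrD// (lt_trans _ me).
apply: countable_bigcupT_measurable; first exact: countableP.
move=> q; case: ifPn => // _.
rewrite /box preimage_bigcap.
apply: fin_bigcap_measurable; first exact: finite_finset.
move=> j _.
have mj : measurable_fun setT (fun z => `|ratr (q.1 0 j) - F z 0 j|).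
  by apply: measurableT_comp => //; apply: measurable_funB.
have := mj measurableT `]-oo, q.2.+1%:R^-1[%classic.
rewrite setTI => /(_ (measurable_itv _)).
congr measurable; apply/seteqP; split => z; rewrite /= in_itv/=//.
Qed.
End borel_rV.

Section measurability.
Context {R : realType} {d : nat} {disp : measure_display} {T : measurableType disp}.
Implicit Types x y : T -> 'rV[R]_d.

Definition coord_measurable x := forall j, measurable_fun setT (fun z => x z 0 j).

Lemma coord_measurable_cst (v : 'rV[R]_d) : coord_measurable (fun=> v).
Proof. by move=> j; exact: measurable_cst. Qed.

Lemma coord_measurableD x y : coord_measurable x -> coord_measurable y ->
  coord_measurable (fun z => x z + y z).
Proof.
move=> mx my j; under eq_fun do rewrite mxE.
exact: measurable_funD (mx j) (my j).
Qed.

Lemma coord_measurableZ a x : coord_measurable x -> coord_measurable (fun z => a *: x z).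
Proof.
move=> mx j; under eq_fun do rewrite mxE.
exact: measurable_funM.
Qed.

Lemma coord_measurableB x y : coord_measurable x -> coord_measurable y ->
  coord_measurable (fun z => x z - y z).
Proof.
move=> mx my; apply: coord_measurableD => // j; under eq_fun do rewrite mxE.
exact: measurableT_comp.
Qed.

Lemma coord_measurable_sum n (x : 'I_n -> T -> 'rV[R]_d) :
  (forall i, coord_measurable (x i)) -> coord_measurable (fun z => \sum_i x i z).
Proof.
move=> mx j; under eq_fun do rewrite summxE.
by apply: measurable_sum => i; exact: mx.
Qed.

Lemma measurable_dot x y : coord_measurable x -> coord_measurable y ->
  measurable_fun setT (fun z => dot (x z) (y z)).
Proof. by move=> mx my; apply: measurable_sum => j; exact: measurable_funM. Qed.

Lemma coord_measurable_grad L f x : smooth L f -> coord_measurable x ->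
  coord_measurable (fun z => grad f (x z)).
Proof.
move=> fL mx j.
apply: (@measurable_continuous_rV _ _ _ _ (fun v => grad f v 0 j)).
  exact: grad_coord_continuous fL.
exact/measurable_rV_coord.
Qed.

Lemma coord_measurable_if (b : T -> bool) x y : measurable_fun setT b ->
  coord_measurable x -> coord_measurable y -> coord_measurable (fun z => if b z then x z else y z).
Proof.
move=> mb mx my j.
rewrite (_ : (fun _ => _) = (fun z => if b z then x z 0 j else y z 0 j)); last first.
  by apply/funext => z; case: (b z).
exact: measurable_fun_ifT.
Qed.

End measurability.

Section state_measurability.
Context {R : realType} {d n : nat}.
Variables (f : 'I_n -> 'rV[R]_d -> R) (g : 'rV[R]_d -> R) (xs : 'rV[R]_d) (L : R).
Hypotheses (f_smooth : forall i, smooth L (f i)) (g_smooth : smooth L g).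
Variables (gamma chi rho p omega : R).
Context {disp : measure_display} {T : measurableType disp}.
Implicit Types s : T -> state R d n.

Definition state_measurable s :=
  [/\ forall i, coord_measurable (fun z => st_x (s z) i),
      forall i, coord_measurable (fun z => st_u (s z) i),
      coord_measurable (fun z => st_y (s z)) & coord_measurable (fun z => st_v (s z))].

Lemma coord_measurable_forward h (x u : T -> 'rV[R]_d) : smooth L h ->
  coord_measurable x -> coord_measurable u ->
  coord_measurable (fun z => forward gamma h (x z) (u z)).
Proof.
move=> hL mx mu; apply: coord_measurableD; last exact: coord_measurableZ.
by apply: coord_measurableB => //; apply: coord_measurableZ; exact: coord_measurable_grad hL mx.
Qed.

Lemma coord_measurable_xhat s i : state_measurable s ->
  coord_measurable (fun z => xhat f gamma (s z) i).
Proof. by move=> [mx mu _ _]; exact: coord_measurable_forward. Qed.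

Lemma coord_measurable_yhat s : state_measurable s ->
  coord_measurable (fun z => yhat g gamma (s z)).
Proof. by move=> [_ _ my mv]; exact: coord_measurable_forward. Qed.

Lemma coord_measurable_gap s i : state_measurable s ->
  coord_measurable (fun z => gap f g gamma (s z) i).
Proof.
by move=> ms; apply: coord_measurableB; [exact: coord_measurable_xhat|exact: coord_measurable_yhat].
Qed.

Lemma state_measurable_step (comp : T -> 'I_n -> 'rV[R]_d -> 'rV[R]_d) (b : T -> bool) s :
  measurable_fun setT b -> state_measurable s ->
  (forall i, coord_measurable (fun z => comp z i (gap f g gamma (s z) i))) ->
  state_measurable (fun z => locodl_step f g gamma chi rho p omega (comp z) (b z) (s z)).
Proof.
move=> mb ms mcg; have [mx mu my mv] := ms.
have mxh := fun i => coord_measurable_xhat i ms.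
have myh := coord_measurable_yhat ms.
pose db z := (2 * n%:R)^-1 *: \sum_i comp z i (gap f g gamma (s z) i).
have mdb : coord_measurable db by apply: coord_measurableZ; exact: coord_measurable_sum.
pose eta := p * chi / (gamma * (1 + 2 * omega)).
split=> [i|i||].
- have := coord_measurable_if mb (coord_measurableD (coord_measurableZ (1 - rho) (mxh i))
    (coord_measurableZ rho (coord_measurableD myh mdb))) (mxh i).
  by congr coord_measurable; apply/funext => z; case: (b z).
- have := coord_measurable_if mb (coord_measurableD (mu i) (coord_measurableZ eta
    (coord_measurableB mdb (mcg i)))) (mu i).
  by congr coord_measurable; apply/funext => z; case: (b z).
- have := coord_measurable_if mb (coord_measurableD myh (coord_measurableZ rho mdb)) myh.
  by congr coord_measurable; apply/funext => z; case: (b z).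
- have := coord_measurable_if mb (coord_measurableD mv (coord_measurableZ eta mdb)) mv.
  by congr coord_measurable; apply/funext => z; case: (b z).
Qed.

Lemma measurable_sqr_sum m (x : 'I_m -> T -> 'rV[R]_d) (y : T -> 'rV[R]_d) (k : R) :
  (forall i, coord_measurable (x i)) -> coord_measurable y ->
  measurable_fun setT (fun z => \sum_i dot (x i z) (x i z) + k * dot (y z) (y z)).
Proof.
move=> mx my; apply: measurable_funD.
  by apply: measurable_sum => i; exact: measurable_dot.
by apply: measurable_funM => //; exact: measurable_dot.
Qed.

Lemma coord_measurable_uerr s i : state_measurable s ->
  coord_measurable (fun z => uerr f xs (s z) i).
Proof. by move=> [_ mu _ _]; apply: coord_measurableB => //; exact: coord_measurable_cst. Qed.

Lemma coord_measurable_verr s : state_measurable s ->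
  coord_measurable (fun z => verr g xs (s z)).
Proof. by move=> [_ _ _ mv]; apply: coord_measurableB => //; exact: coord_measurable_cst. Qed.

Lemma measurable_lyapunov s : state_measurable s ->
  measurable_fun setT (fun z => lyapunov f g gamma chi p omega xs (s z)).
Proof.
move=> ms; have [mx mu my mv] := ms.
under eq_fun do rewrite lyapunov_dot.
apply: measurable_funD; apply: measurable_funM => //.
  by apply: measurable_sqr_sum => [i|]; apply: coord_measurableB => //; exact: coord_measurable_cst.
by apply: measurable_sqr_sum => [i|]; [exact: coord_measurable_uerr|exact: coord_measurable_verr].
Qed.

Lemma measurable_step_bound (b : T -> bool) s : measurable_fun setT b -> state_measurable s ->
  measurable_fun setT (fun z => step_bound f g xs gamma chi p omega (b z) (s z)).
Proof.
move=> mb ms.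
have mg := fun i => coord_measurable_gap i ms.
have mh : coord_measurable (fun z => half_gap f g gamma (s z)).
  by apply: coord_measurableZ; exact: coord_measurable_sum.
have mu := fun i => coord_measurable_uerr i ms.
have mv := coord_measurable_verr ms.
have mxs := coord_measurable_cst xs.
apply: measurable_funD; first apply: measurable_funD; try apply: measurable_funM => //.
- by apply: measurable_sqr_sum => [i|]; apply: coord_measurableB => //;
    [exact: coord_measurable_xhat|exact: coord_measurable_yhat].
- exact: measurable_sqr_sum.
- have mD : measurable_fun setT (fun z => disagreement f g gamma (s z)).
    apply: measurable_funB.
      by apply: measurable_sum => i; exact: measurable_dot.
    by apply: measurable_funM => //; exact: measurable_dot.
  have mK : measurable_fun setT (fun z => coupling f g xs gamma (s z)).
    apply: measurable_funD.
      by apply: measurable_sum => i; apply: measurable_dot => //; exact: coord_measurableB.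
    by apply: measurable_funM => //; exact: measurable_dot.
  apply: measurable_fun_ifT => //.
  apply: measurable_funD; apply: measurable_funM => //.
  by apply: measurable_funD; apply: measurable_funM.
Qed.

End state_measurability.

(** * Expectation of one communication step *)

Section integral.
Context {R : realType} {disp : measure_display} {Omega : measurableType disp}.
Variable P : probability Omega R.

Lemma integral_le_affine_quadratic (Z L Q : Omega -> R) (c0 q : R) :
  measurable_fun setT Z -> (forall w, 0 <= Z w) ->
  (forall w, Z w <= c0 + L w + Q w) ->
  P.-integrable setT (EFin \o L) -> (\int[P]_w (L w)%:E = 0)%E ->
  measurable_fun setT Q -> (forall w, 0 <= Q w) ->
  (\int[P]_w (Q w)%:E <= q%:E)%E ->
  (\int[P]_w (Z w)%:E <= (c0 + q)%:E)%E.
Proof.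
move=> mZ Z0 ZLQ iL L0 mQ Q0 Qq.
have mL : measurable_fun setT L.
  by apply/measurable_EFinP; case/integrableP : iL.
have mEQ : measurable_fun setT (EFin \o Q) by exact/measurable_EFinP.
have iQ : P.-integrable setT (EFin \o Q).
  apply/integrableP; split => //.
  under eq_integral => w _ do rewrite /= ger0_norm//.
  by apply: le_lt_trans Qq _; rewrite ltry.
have ic : P.-integrable setT (EFin \o cst c0).
  exact: finite_measure_integrable_cst.
apply: (@le_trans _ _ (\int[P]_w ((c0%:E + (L w)%:E) + (Q w)%:E))%E).
  apply: ge0_le_integral => //.
  - by move=> w _; rewrite lee_fin.
  - exact/measurable_EFinP.
  - apply: emeasurable_funD => //; apply: emeasurable_funD; exact/measurable_EFinP.
  - by move=> w _; rewrite -!EFinD lee_fin.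
rewrite integralD//; last exact: integrableD.
rewrite integralD// L0 adde0 integral_cst//= probability_setT mule1 EFinD.
by rewrite leeD2l.
Qed.

(** By |X| <= 1 + X^2, since the measure is finite. *)
Lemma integrable_of_sqr (X Z : Omega -> R) (z : R) :
  measurable_fun setT X -> measurable_fun setT Z ->
  (forall w, X w ^+ 2 <= Z w) -> (\int[P]_w (Z w)%:E <= z%:E)%E ->
  P.-integrable setT (EFin \o X).
Proof.
move=> mX mZ XZ Zz.
have Z0 w : 0 <= Z w by apply: le_trans (XZ w); exact: sqr_ge0.
apply/integrableP; split; first exact/measurable_EFinP.
apply: (@le_lt_trans _ _ (\int[P]_w (1%:E + (Z w)%:E))%E).
  apply: ge0_le_integral => //.
  - by apply: measurableT_comp => //; exact/measurable_EFinP.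
  - by apply: emeasurable_funD => //; exact/measurable_EFinP.
  - move=> w _; rewrite /= -EFinD lee_fin.
    have := XZ w; rewrite -(real_normK (num_real (X w))).
    have := sqr_ge0 (`|X w| - 1); have := normr_ge0 (X w).
    move: `|X w| => a a0; rewrite sqrrB mulr1 expr1n => h1 h2.
    nra.
rewrite ge0_integralD//; last 2 first.
- by move=> w _; rewrite lee_fin.
- exact/measurable_EFinP.
rewrite integral_cst//= probability_setT mule1.
by rewrite (le_lt_trans (leeD2l _ Zz))// -EFinD ltry.
Qed.

Lemma integral_noise_dot n d (l : 'I_n -> 'rV[R]_d) (xi : 'I_n -> Omega -> 'rV[R]_d) :
  (forall i j, P.-integrable setT (EFin \o (fun w => xi i w 0 j))) ->
  (forall i j, \int[P]_w (xi i w 0 j)%:E = 0)%E ->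
  P.-integrable setT (EFin \o (fun w => \sum_i dot (l i) (xi i w))) /\
  (\int[P]_w (\sum_i dot (l i) (xi i w))%:E = 0)%E.
Proof.
move=> ixi xi0.
have E : EFin \o (fun w => \sum_i dot (l i) (xi i w)) =
   (fun w => \sum_i \sum_j (l i 0 j)%:E * (xi i w 0 j)%:E)%E.
  apply/funext => w /=; rewrite -sumEFin; apply: eq_bigr => i _.
  by rewrite /dot -sumEFin; apply: eq_bigr => j _; rewrite EFinM.
have ilin i j : P.-integrable setT (fun w => (l i 0 j)%:E * (xi i w 0 j)%:E)%E.
  by apply: integrableZl => //; exact: ixi.
set L := fun w => _; rewrite -[X in _ /\ X]/(\int[P]_w ((EFin \o L) w) = 0)%E E {}/L; split.
  by apply: integrable_sum => // i _; apply: integrable_sum => // j _; exact: ilin.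
rewrite integral_sum//; last by move=> i; apply: integrable_sum => // j _; exact: ilin.
rewrite big1// => i _; rewrite integral_sum//.
rewrite big1// => j _; rewrite integralZl//; last exact: ixi.
by rewrite xi0 mule0.
Qed.

End integral.

Section expected_step.
Context {R : realType} {d n : nat}.
Hypothesis n_gt0 : (0 < n)%N.
Variables (f : 'I_n -> 'rV[R]_d -> R) (g : 'rV[R]_d -> R) (xs : 'rV[R]_d) (L : R).
Hypotheses (f_smooth : forall i, smooth L (f i)) (g_smooth : smooth L g).
Variables (gamma chi rho p omega omega_av : R).
Hypotheses (gamma_gt0 : 0 < gamma) (chi_gt0 : 0 < chi) (p_gt0 : 0 < p)
  (omega_ge0 : 0 <= omega) (omega_av_ge0 : 0 <= omega_av)
  (rho_chi : 0 <= 2 * rho - rho ^+ 2 * (1 + omega_av) - chi).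
Context {disp : measure_display} {Omega : measurableType disp} (P : probability Omega R).
Variable comp : 'I_n -> Omega -> 'rV[R]_d -> 'rV[R]_d.
Hypotheses (comp_meas : forall i x, coord_measurable (fun w => comp i w x))
  (comp_unbiased : forall i, unbiased_compressor P omega (comp i))
  (comp_av : forall x : 'I_n -> 'rV[R]_d,
    ('E_P[fun w => (enorm (n%:R^-1 *: \sum_(i < n) (comp i w (x i) - x i)) ^+ 2)%R]
       <= (omega_av / n%:R * \sum_(i < n) enorm (x i) ^+ 2)%:E)%E).

Lemma noise_sqr_le i (x : 'rV[R]_d) :
  (\int[P]_w (dot (comp i w x - x) (comp i w x - x))%:E <= (omega * dot x x)%:E)%E.
Proof.
have [_] := comp_unbiased i x.
rewrite unlock /expectation sqr_enorm.
by under eq_integral do rewrite sqr_enorm.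
Qed.

(** The variance bound makes the noise integrable, so that unbiasedness can be
subtracted under the integral. *)
Lemma noise_mean i (x : 'rV[R]_d) j :
  P.-integrable setT (EFin \o (fun w => (comp i w x - x) 0 j)) /\
  (\int[P]_w ((comp i w x - x) 0 j)%:E = 0)%E.
Proof.
have mn : coord_measurable (fun w => comp i w x - x).
  by apply: coord_measurableB => //; exact: coord_measurable_cst.
have int_noise : P.-integrable setT (EFin \o (fun w => (comp i w x - x) 0 j)).
  apply: (integrable_of_sqr (mn j) (measurable_dot mn mn) _ (noise_sqr_le i x)) => w.
  exact: sqr_coord_le.
split=> //.
have [/(_ j) + _] := comp_unbiased i x; rewrite unlock => mean.
have ic : P.-integrable setT (EFin \o cst (x 0 j)) by exact: finite_measure_integrable_cst.
have -> : (\int[P]_w ((comp i w x - x) 0 j)%:E =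
    \int[P]_w ((comp i w x 0 j)%:E - (x 0 j)%:E))%E.
  by apply: eq_integral => w _; rewrite !mxE EFinB.
rewrite integralB//.
- by rewrite [X in (X - _)%E]mean integral_cst//= probability_setT mule1 subee.
- have := integrableD measurableT int_noise ic; apply: eq_integrable => // w _.
  by rewrite /= !mxE -EFinD subrK.
Qed.

(** In [lyapunov_step_true_le], the first-order noise integrates to zero and the
two quadratic terms are bounded by the two variance assumptions. *)
Lemma expected_step_true_le s :
  (\int[P]_w (lyapunov f g gamma chi p omega xs
     (locodl_step f g gamma chi rho p omega (fun i => comp i w) true s))%:E
   <= (step_bound f g xs gamma chi p omega true s)%:E)%E.
Proof.
pose xi i w := comp i w (gap f g gamma s i) - gap f g gamma s i.
have mxi i : coord_measurable (xi i).
  by apply: coord_measurableB => //; exact: coord_measurable_cst.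
pose eta := p * chi / (gamma * (1 + 2 * omega)).
pose c := gamma * (1 + 2 * omega) / (p ^+ 2 * chi).
pose q1 w := dot (n%:R^-1 *: \sum_i xi i w) (n%:R^-1 *: \sum_i xi i w).
pose q2 w := \sum_i dot (xi i w) (xi i w).
pose D := \sum_i dot (gap f g gamma s i) (gap f g gamma s i).
pose k1 := n%:R * rho ^+ 2 / (2 * gamma); pose k2 := c * eta ^+ 2.
have k10 : 0 <= k1 by rewrite /k1 divr_ge0// mulr_ge0 ?sqr_ge0// ltW.
have k20 : 0 <= k2.
  by rewrite /k2 mulr_ge0 ?sqr_ge0// /c divr_ge0 ?mulr_ge0 ?sqr_ge0 ?ltW// ltr_wpDr// mulr_ge0.
have mq1 : measurable_fun setT q1.
  by apply: measurable_dot; apply: coord_measurableZ; exact: coord_measurable_sum.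
have mq2 : measurable_fun setT q2.
  by apply: measurable_sum => i; exact: measurable_dot.
have q10 w : 0 <= q1 w by exact: dot_ge0.
have q20 w : 0 <= q2 w by apply: sumr_ge0 => i _; exact: dot_ge0.
apply: (@le_trans _ _ (noiseless_value f g xs gamma chi rho p omega s
   + (k1 * (omega_av / n%:R * D) + k2 * (omega * D)))%:E); last first.
  rewrite lee_fin addrA; exact: noise_budget.
have [iL L0] := @integral_noise_dot _ _ _ P _ _
  (noise_direction f g xs gamma chi rho p omega s) xi
  (fun i j => (noise_mean i _ j).1) (fun i j => (noise_mean i _ j).2).
apply: (@integral_le_affine_quadratic _ _ _ P _ _ (fun w => k1 * q1 w + k2 * q2 w)
  _ _ _ _ _ iL L0).
- apply: (@measurable_lyapunov _ _ _ f g xs gamma chi p omega _ Omega).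
  apply: (@state_measurable_step _ _ _ f g L f_smooth g_smooth gamma chi rho p omega _ Omega
     (fun w i => comp i w) (fun=> true) (fun=> s)) => //.
  by split => *; exact: coord_measurable_cst.
- by move=> w; exact: lyapunov_ge0.
- move=> w; apply: le_trans; first exact: lyapunov_step_true_le.
  by apply: le_of_eq; rewrite /noiseless_value /noise -!addrA.
- by apply: measurable_funD; exact: measurable_funM.
- by move=> w; rewrite addr_ge0// mulr_ge0.
have mEq1 : measurable_fun setT (EFin \o q1) by exact/measurable_EFinP.
have mEq2 : measurable_fun setT (EFin \o q2) by exact/measurable_EFinP.
under eq_integral do rewrite EFinD !EFinM.
rewrite ge0_integralD//; first last.
- exact: measurable_funeM.
- by move=> w _; rewrite mule_ge0// lee_fin.
- exact: measurable_funeM.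
- by move=> w _; rewrite mule_ge0// lee_fin.
rewrite !ge0_integralZl_EFin//; [|by move=> w _; rewrite lee_fin..].
rewrite EFinD !EFinM; apply: leeD; rewrite lee_wpmul2l ?lee_fin//.
  have := comp_av (gap f g gamma s); rewrite unlock /=.
  under eq_integral do rewrite sqr_enorm.
  by under eq_bigr do rewrite sqr_enorm.
under eq_integral do rewrite -sumEFin.
rewrite ge0_integral_sum//; last 2 first.
- by move=> i; apply/measurable_EFinP; exact: measurable_dot.
- by move=> i w _; rewrite lee_fin dot_ge0.
rewrite -EFinM /D mulr_sumr -sumEFin; apply: lee_sum => i _.
exact: noise_sqr_le.
Qed.
End expected_step.

(** * Independence and iterated integrals *)

Section independent_fubini.
Context {R : realType} {disp : measure_display} {Omega : measurableType disp}.
Variables (P : probability Omega R) (F H : set (set Omega)).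
Hypotheses (sF : is_sub_sigma_algebra F) (sH : is_sub_sigma_algebra H).
Hypothesis FH : forall A B, F A -> H B -> P (A `&` B) = (P A * P B)%E.

Lemma measurable_sub_sigma (G : set (set Omega)) : is_sub_sigma_algebra G ->
  measurable_fun setT (idfun : Omega -> g_sigma_algebraType G).
Proof.
move=> [sG Gm] _ A; rewrite /measurable/= sigma_algebra_id// => GA.
by rewrite setTI; exact: Gm.
Qed.

Let idF : {mfun Omega >-> g_sigma_algebraType F} :=
  HB.pack (idfun : Omega -> g_sigma_algebraType F)
    (isMeasurableFun.Build _ _ _ _ _ (measurable_sub_sigma sF)).
Let idH : {mfun Omega >-> g_sigma_algebraType H} :=
  HB.pack (idfun : Omega -> g_sigma_algebraType H)
    (isMeasurableFun.Build _ _ _ _ _ (measurable_sub_sigma sH)).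

Let diag_meas : measurable_fun setT
  (fun w : Omega => (idF w, idH w)).
Proof. by apply: measurable_fun_pair; exact: measurable_funP. Qed.

Let diag : {mfun Omega >-> (g_sigma_algebraType F * g_sigma_algebraType H)%type} :=
  HB.pack (fun w : Omega => (idF w, idH w))
    (isMeasurableFun.Build _ _ _ _ _ diag_meas).

(** Independence says that the diagonal map sends P to a measure that agrees with
the product of the restrictions of P to F and H on rectangles, hence everywhere.
Tonelli's theorem then allows the first argument to be frozen. *)
Lemma integral_diag_indep_le
    (K : g_sigma_algebraType F * g_sigma_algebraType H -> \bar R)
    (M : g_sigma_algebraType F -> \bar R) :
  measurable_fun setT K -> (forall z, 0 <= K z)%E -> measurable_fun setT M ->
  (forall w1, \int[P]_w2 K (w1, w2) <= M w1)%E ->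
  (\int[P]_w K (w, w) <= \int[P]_w M w)%E.
Proof.
move=> mK K0 mM KM.
pose m1 := distribution P idF; pose m2 := distribution P idH.
have KE w1 : (\int[m2]_w2 K (w1, w2) = \int[P]_w2 K (w1, w2))%E.
  rewrite ge0_integral_distribution//.
  by apply: measurableT_comp => //; exact: measurable_pair1.
have M0 w1 : (0 <= M w1)%E by apply: le_trans (KM w1); exact: integral_ge0.
have -> : (\int[P]_w K (w, w) = \int[distribution P diag]_z K z)%E.
  by rewrite ge0_integral_distribution.
have -> : (\int[distribution P diag]_z K z = \int[m1 \x m2]_z K z)%E.
  apply: eq_measure_integral => A mA _; apply/esym.
  apply: product_measure_unique => // B C.
  rewrite /measurable/= !sigma_algebra_id; [|exact: sH.1|exact: sF.1] => FB HC.
  exact: FH.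
rewrite fubini_tonelli1//.
have -> : (\int[P]_w M w = \int[m1]_w M w)%E by rewrite ge0_integral_distribution.
apply: ge0_le_integral => //.
- by move=> w _; exact: integral_ge0.
- exact: measurable_fun_fubini_tonelli_F.
- by move=> w _; rewrite /fubini_F KE.
Qed.
End independent_fubini.

Section past.
Context {R : realType} {disp : measure_display} {Omega : measurableType disp}.
Variables (P : probability Omega R) (I : choiceType) (F : I -> set (set Omega)).
Hypothesis F_sigma : forall i, is_sub_sigma_algebra (F i).
Local Open Scope fset_scope.

(** A pi-system generating the joint sigma-algebra of the sources in J. *)
Definition cylinders (J : {fset I}) : set (set Omega) :=
  [set B | exists2 A : I -> set Omega, (forall i, i \in J -> F i (A i)) &
     B = (\bigcap_(i in [set` J]) A i)%classic].

Definition joint_sigma (J : {fset I}) := <<s cylinders J >>%classic.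

Lemma sigma_setT i : F i setT.
Proof.
have [[F0 FC _] _] := F_sigma i.
by rewrite -(setD0 setT); exact: FC.
Qed.

Lemma cylinders_mono J K : {subset J <= K} -> (cylinders J `<=` cylinders K)%classic.
Proof.
move=> JK B [A FA ->].
exists (fun i => if i \in J then A i else setT).
  by move=> i iK; case: ifPn => iJ; [exact: FA|exact: sigma_setT].
apply/seteqP; split => w h i /=.
  by move=> iK; case: ifPn => // iJ; exact: h.
by move=> iJ; have := h i (JK _ iJ); rewrite /= iJ.
Qed.

Lemma joint_sigma_mono J K : {subset J <= K} -> (joint_sigma J `<=` joint_sigma K)%classic.
Proof. by move=> JK; apply: sub_sigma_algebra2; exact: cylinders_mono. Qed.

Lemma sub_joint_sigma J i : i \in J -> (F i `<=` joint_sigma J)%classic.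
Proof.
move=> iJ A FA; apply: sub_sigma_algebra.
exists (fun j => if j == i then A else setT).
  by move=> j jJ; case: eqP => [->//|_]; exact: sigma_setT.
apply/seteqP; split => w h; first by move=> j _ /=; case: eqP.
by have := h i iJ; rewrite /= eqxx.
Qed.

Lemma joint_sigma_sub J : is_sub_sigma_algebra (joint_sigma J).
Proof.
split; first exact: smallest_sigma_algebra.
apply: smallest_sub; first exact: sigma_algebra_measurable.
move=> _ [A FA ->]; apply: fin_bigcap_measurable; first exact: finite_fset.
by move=> i iJ; apply: (F_sigma i).2; exact: FA.
Qed.

Lemma cylinders_setI J : setI_closed (cylinders J).
Proof.
move=> _ _ [A FA ->] [B FB ->]; exists (fun i => A i `&` B i)%classic.
  move=> i iJ; have [sF _] := F_sigma i.
  have := FB i iJ; have := FA i iJ.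
  rewrite -(sigma_algebra_id sF).
  exact: (@measurableI _ (g_sigma_algebraType (F i))).
by rewrite bigcapI.
Qed.

Lemma cylinders_setT J : cylinders J setT.
Proof.
exists (fun=> setT); first by move=> i _; exact: sigma_setT.
by apply/seteqP; split.
Qed.

(** For fixed B, the finite measures A |-> P (A `&` B) and A |-> P A * P B agree
on the pi-system of cylinders by independence, hence on the generated
sigma-algebra. *)
Lemma joint_sigma_indep (J : {fset I}) k A B : mutually_independent P F -> k \notin J ->
  joint_sigma J A -> F k B -> P (A `&` B)%classic = (P A * P B)%E.
Proof.
move=> indep kJ JA FB.
have mB : measurable B by exact: (F_sigma k).2.
have PB0 : 0 <= fine (P B) by rewrite fine_ge0.
have PBE : (fine (P B))%:E = P B by rewrite fineK// fin_num_measure.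
have mid := measurable_sub_sigma (joint_sigma_sub J).
pose idJ : Omega -> g_sigma_algebraType (joint_sigma J) := idfun.
pose m1 : {measure set _ -> \bar R} := pushforward (mrestr P mB) idJ.
pose m2 : {measure set _ -> \bar R} := pushforward (mscale (NngNum PB0) P) idJ.
have -> : P (A `&` B)%classic = m1 mid A by [].
have -> : (P A * P B)%E = m2 mid A by rewrite /m2/= /pushforward/= /mscale/= PBE muleC.
apply: (@measure_unique _ R (g_sigma_algebraType (joint_sigma J)) (cylinders J)
  (fun=> setT) _ _ _ _ (m1 mid) (m2 mid)) => //.
- exact: (sigma_algebra_id (joint_sigma_sub J).1).
- exact: cylinders_setI.
- by move=> _; exact: cylinders_setT.
- by apply/seteqP; split => // w _; exists 0%N.
- move=> _ [D FD ->]; rewrite /m1 /m2/= /pushforward/= /mscale/= PBE /mrestr/=.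
  pose E i := if i == k then B else D i.
  have EJ i : i \in J -> E i = D i.
    by rewrite /E => iJ; case: eqP => // ik; rewrite -ik iJ in kJ.
  have DE : (\bigcap_(i in [set` J]) D i = \bigcap_(i in [set` J]) E i)%classic.
    by apply: eq_bigcapr => i iJ; rewrite EJ.
  have -> : ((\bigcap_(i in [set` J]) D i) `&` B = \bigcap_(i in [set` (k |` J)%fset]) E i)%classic.
    rewrite DE; apply/seteqP; split => w.
      move=> [h Bw] i /=; rewrite !inE => /predU1P[->|iJ]; first by rewrite /E eqxx.
      exact: h.
    move=> h; split => [i iJ|]; first by apply: h; rewrite /= !inE iJ orbT.
    by have := h k; rewrite /= /E eqxx; apply; rewrite !inE eqxx.
  rewrite DE !indep.
  + by rewrite big_fsetU1//= {1}/E eqxx.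
  + by move=> i iJ; rewrite EJ//; exact: FD.
  + move=> i; rewrite !inE => /predU1P[->|iJ]; first by rewrite /E eqxx.
    by rewrite EJ//; exact: FD.
- by move=> _; rewrite /m1/= /pushforward/= /mrestr preimage_setT setTI ltey_eq fin_num_measure.
- by rewrite /measurable/= (sigma_algebra_id (joint_sigma_sub J).1).
Qed.

End past.

Section refine.
Context {R : realType} {d : nat} {disp : measure_display} {Omega : measurableType disp}.

Lemma measurable_refine (F1 F2 : set (set Omega)) : F1 `<=` F2 ->
  measurable_fun setT (idfun : g_sigma_algebraType F2 -> g_sigma_algebraType F1).
Proof.
by move=> F12 _ A mA; rewrite setTI; exact: sub_sigma_algebra2 F12 _ mA.
Qed.

Lemma coord_measurable_comp d1 d2 (T1 : measurableType d1) (T2 : measurableType d2)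
    (h : T1 -> T2) (x : T2 -> 'rV[R]_d) :
  measurable_fun setT h -> coord_measurable x -> coord_measurable (x \o h).
Proof. by move=> mh mx j; exact: measurableT_comp (mx j) mh. Qed.

(** The argument x may depend on the outcome: this is where the joint
measurability of the operator in outcome and argument is used. *)
Lemma coord_measurable_random_operator (G : set (set Omega)) (Cc : Omega -> 'rV[R]_d -> 'rV[R]_d)
    d1 (T : measurableType d1) (h : T -> g_sigma_algebraType G) (x : T -> 'rV[R]_d) :
  random_operator G Cc -> measurable_fun setT h -> coord_measurable x ->
  coord_measurable (fun z => Cc (h z) (x z)).
Proof.
move=> mC mh mx; apply/measurable_rV_coord.
have mp : measurable_fun setT (fun z => (h z, x z : borel_rV R d)).
  by apply: measurable_fun_pair => //; exact/measurable_rV_coord.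
exact: measurableT_comp mC mp.
Qed.

Lemma integral_coin (P : probability Omega R) (theta : Omega -> bool) (p : R) (h : bool -> R) :
  measurable_fun setT theta -> P (theta @^-1` [set true]) = p%:E -> (forall b, 0 <= h b) ->
  (\int[P]_w (h (theta w))%:E = (p * h true + (1 - p) * h false)%:E)%E.
Proof.
move=> mtheta thetap h0.
set A := theta @^-1` [set true] in thetap.
have mA : measurable A by rewrite -[A]setTI; exact: mtheta.
transitivity (\int[P]_w ((h true)%:E * (\1_A w)%:E + (h false)%:E * (\1_(~` A) w)%:E))%E.
  apply: eq_integral => w _; rewrite !indicE in_setC -!EFinM -EFinD; congr EFin.
  have -> : (w \in A) = theta w by apply/idP/idP => [/set_mem|th]; [|exact: mem_set].
  by case: (theta w); rewrite /= mulr1 mulr0 ?addr0 ?add0r.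
have mI B : measurable B -> measurable_fun setT (EFin \o (\1_B : Omega -> R)).
  by move=> mB; apply/measurable_EFinP; exact: measurable_indic.
have kB0 (k : R) B (w : Omega) : 0 <= k -> (0 <= k%:E * (\1_B w)%:E)%E.
  by move=> k0; rewrite mule_ge0// lee_fin.
have mk (k : R) B : measurable B ->
    measurable_fun setT (fun w : Omega => (k%:E * (\1_B w)%:E)%E).
  by move=> mB; apply: measurable_funeM; exact: mI.
rewrite (ge0_integralD P measurableT (fun w _ => kB0 _ A w (h0 true)) (mk _ _ mA)
  (fun w _ => kB0 _ (~` A) w (h0 false)) (mk _ _ (measurableC mA))).
have IB (k : R) B : 0 <= k -> measurable B ->
    (\int[P]_w (k%:E * (\1_B w : R)%:E) = k%:E * P B)%E.
  move=> k0 mB; rewrite ge0_integralZl_EFin//; last exact: mI.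
  by rewrite integral_indic// setIT.
rewrite !IB//; last exact: measurableC.
rewrite probability_setC// thetap -!EFinB -!EFinM -EFinD.
by rewrite mulrC [X in _ + X]mulrC.
Qed.

End refine.

(** * Contraction in expectation *)

Section convergence.
Variables (R : realType) (d n : nat) (hn : (0 < n)%N)
    (mu L : R) (hmuL : mu <= L)
    (f : 'I_n -> 'rV[R]_d -> R) (g : 'rV[R]_d -> R)
    (f_smooth : forall i, smooth L (f i)) (g_smooth : smooth L g)
    (f_cvx : forall i, strongly_convex mu (f i)) (g_cvx : strongly_convex mu g)
    (xs : 'rV[R]_d)
    (gradx : \sum_i grad (f i) xs + n%:R *: grad g xs = 0)
    (gamma chi rho p omega omega_av : R)
    (gamma_gt0 : 0 < gamma) (chi_gt0 : 0 < chi) (p_gt0 : 0 < p)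
    (omega_ge0 : 0 <= omega) (omega_av_ge0 : 0 <= omega_av)
    (disp : measure_display) (Omega : measurableType disp)
    (P : probability Omega R)
    (G : nat -> set (set Omega))
    (C : 'I_n -> nat -> Omega -> 'rV[R]_d -> 'rV[R]_d)
    (theta : nat -> Omega -> bool)
    (G_sigma : forall t, is_sub_sigma_algebra (G t))
    (C_random : forall i t, random_operator (G t) (C i t))
    (theta_meas : forall t, measurable_fun setT (theta t))
    (theta_prob : forall t, P (theta t @^-1` [set true]) = p%:E).
(** [inl t] stands for the compressors of iteration t, [inr t] for its coin. *)
Definition source (k : nat + nat) : set (set Omega) :=
  match k with inl t => G t | inr t => sigma_rv (theta t) end.
Hypotheses (indep : mutually_independent P source)
    (C_unbiased : forall i t, unbiased_compressor P omega (C i t))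
    (C_av : forall (t : nat) (x : 'I_n -> 'rV[R]_d),
       ('E_P[fun w => (enorm (n%:R^-1 *: \sum_(i < n) (C i t w (x i) - x i)) ^+ 2)%R]
          <= (omega_av / n%:R * \sum_(i < n) enorm (x i) ^+ 2)%:E)%E)
    (rho_chi : 0 <= 2 * rho - rho ^+ 2 * (1 + omega_av) - chi).
Variable s0 : state R d n.
Hypothesis s0_sum : \sum_(i < n) st_u s0 i + n%:R *: st_v s0 = 0.

Let S := locodl f g gamma chi rho p omega C theta s0.
Let Psi := lyapunov f g gamma chi p omega xs.
Let tau := Num.max (Num.max ((1 - gamma * mu) ^+ 2) ((1 - gamma * L) ^+ 2))
                     (1 - p ^+ 2 * chi / (1 + 2 * omega)).

Lemma source_sigma k : is_sub_sigma_algebra (source k).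
Proof.
case: k => t /=; first exact: G_sigma.
split; first by apply: sigma_algebra_preimage; exact: sigma_algebra_measurable.
by move=> _ [B mB <-]; exact: theta_meas.
Qed.

Fixpoint history t : {fset nat + nat} :=
  if t is t'.+1 then (inl t' |` (inr t' |` history t'))%fset else fset0.

Lemma history_lt t k : k \in history t -> (match k with inl s => s | inr s => s end < t)%N.
Proof.
elim: t => [|t IH] /=; first by rewrite inE.
rewrite !inE => /orP[/eqP->//|/orP[/eqP->//|/IH h]].
exact: ltnW.
Qed.

Let past t := joint_sigma source (history t).
(** The information available once the coin of iteration t is drawn, before its
compressors are. *)
Let past_coin t := joint_sigma source (inr t |` history t)%fset.

Lemma theta_past_coin t : measurable_fun setT (theta t : g_sigma_algebraType (past_coin t) -> bool).
Proof.
have h : measurable_fun setT (theta t : g_sigma_algebraType (sigma_rv (theta t)) -> bool).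
  exact: preimage_set_system_measurable_fun.
have sub : sigma_rv (theta t) `<=` past_coin t.
  by apply: (sub_joint_sigma source_sigma (i := inr t)); rewrite !inE eqxx.
exact: measurableT_comp h (measurable_refine sub).
Qed.

Lemma state_measurable_comp d1 d2 (T1 : measurableType d1) (T2 : measurableType d2)
    (h : T1 -> T2) (s : T2 -> state R d n) :
  measurable_fun setT h -> state_measurable s -> state_measurable (s \o h).
Proof.
move=> mh [mx mu' my mv]; split=> [i|i||];
  [exact: coord_measurable_comp mh (mx i)|exact: coord_measurable_comp mh (mu' i)
  |exact: coord_measurable_comp mh my|exact: coord_measurable_comp mh mv].
Qed.

Lemma locodl_step_measurable t d1 (T : measurableType d1) (b : T -> bool)
    (h : T -> g_sigma_algebraType (G t)) (s : T -> state R d n) :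
  measurable_fun setT b -> measurable_fun setT h -> state_measurable s ->
  state_measurable (fun z => locodl_step f g gamma chi rho p omega
     (fun i => C i t (h z)) (b z) (s z)).
Proof.
move=> mb mh ms.
apply: (@state_measurable_step _ _ _ f g L f_smooth g_smooth gamma chi rho p omega _ T
     (fun z i => C i t (h z)) b s) => // i.
exact: (coord_measurable_random_operator (x := fun z => gap f g gamma (s z) i)
  (@C_random i t) mh (coord_measurable_gap f_smooth g_smooth gamma i ms)).
Qed.

Lemma iterate_measurable t :
  state_measurable (fun w : g_sigma_algebraType (past t) => S t w).
Proof.
elim: t => [|t IH]; first by split => *; exact: coord_measurable_cst.
apply: (@locodl_step_measurable t _ (g_sigma_algebraType (past t.+1)) (theta t) idfun (S t)).
- have sub : past_coin t `<=` past t.+1.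
    by apply: (joint_sigma_mono source_sigma) => k; rewrite !inE => ->; rewrite orbT.
  exact: measurableT_comp (@theta_past_coin t) (measurable_refine sub).
- have sub : G t `<=` past t.+1.
    by apply: (sub_joint_sigma source_sigma (i := inl t)); rewrite !inE eqxx.
  exact: measurable_refine sub.
- have sub : past t `<=` past t.+1.
    by apply: (joint_sigma_mono source_sigma) => k; rewrite !inE => ->; rewrite !orbT.
  exact: state_measurable_comp (measurable_refine sub) IH.
Qed.

Lemma indep_past_coin t A B : past t A -> source (inr t) B ->
  P (A `&` B) = (P A * P B)%E.
Proof.
apply: (joint_sigma_indep source_sigma indep).
by apply/negP => /history_lt; rewrite ltnn.
Qed.

Lemma indep_past_compressor t A B : past_coin t A -> source (inl t) B ->
  P (A `&` B) = (P A * P B)%E.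
Proof.
apply: (joint_sigma_indep source_sigma indep).
rewrite !inE /=; apply/negP => /history_lt; by rewrite ltnn.
Qed.

Lemma coord_measurable_compressor i t x : coord_measurable (fun w : Omega => C i t w x).
Proof.
exact: (coord_measurable_random_operator (x := fun=> x) (@C_random i t)
  (measurable_sub_sigma (G_sigma t)) (@coord_measurable_cst _ _ _ _ x)).
Qed.

Lemma expected_compressor_step_le t s :
  (\int[P]_w (Psi (locodl_step f g gamma chi rho p omega (fun i => C i t w) true s))%:E
   <= (step_bound f g xs gamma chi p omega true s)%:E)%E.
Proof.
exact: (expected_step_true_le hn xs f_smooth g_smooth gamma_gt0 chi_gt0 p_gt0 omega_ge0
  omega_av_ge0 rho_chi (comp := fun i => C i t) (fun i x => coord_measurable_compressor i t x)
  (fun i => @C_unbiased i t) (@C_av t)).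
Qed.

(** It is at least an expectation of values of the Lyapunov function. *)
Lemma step_bound_ge0 b s : 0 <= step_bound f g xs gamma chi p omega b s.
Proof.
case: b; last first.
  by rewrite -(lyapunov_step_false f g xs gamma chi rho p omega (fun=> id)); exact: lyapunov_ge0.
rewrite -lee_fin.
have := expected_compressor_step_le 0 s.
apply: le_trans.
by apply: integral_ge0 => w _; rewrite lee_fin; exact: lyapunov_ge0.
Qed.

Lemma dual_sum_locodl t w : \sum_i st_u (S t w) i + n%:R *: st_v (S t w) = 0.
Proof. by elim: t => [//|t IH]; exact: dual_sum_step. Qed.

Lemma tau_ge0 : 0 <= tau.
Proof. by rewrite /tau !le_max sqr_ge0. Qed.

Lemma Psi_measurable t : measurable_fun setT (fun w : Omega => Psi (S t w)).
Proof.
have ms := state_measurable_comp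
  (measurable_sub_sigma (joint_sigma_sub source_sigma (history t))) (iterate_measurable t).
exact: (measurable_lyapunov f g xs gamma chi p omega ms).
Qed.

(** The compressors of iteration t are independent of its coin and of the past,
which are frozen. *)
Lemma expected_Psi_compressor t :
  (\int[P]_w (Psi (S t.+1 w))%:E <=
   \int[P]_w (step_bound f g xs gamma chi p omega (theta t w) (S t w))%:E)%E.
Proof.
have sub : past t `<=` past_coin t.
  by apply: (joint_sigma_mono source_sigma) => k; rewrite !inE => ->; rewrite orbT.
have mS := state_measurable_comp (measurable_refine sub) (iterate_measurable t).
pose K (z : g_sigma_algebraType (past_coin t) * g_sigma_algebraType (G t)) : \bar R :=
  (Psi (locodl_step f g gamma chi rho p omega (fun i => C i t z.2) (theta t z.1) (S t z.1)))%:E.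
pose M (w : g_sigma_algebraType (past_coin t)) : \bar R :=
  (step_bound f g xs gamma chi p omega (theta t w) (S t w))%:E.
apply: (integral_diag_indep_le (joint_sigma_sub source_sigma _) (G_sigma t)
  (@indep_past_compressor t) (K := K) (M := M)).
- apply/measurable_EFinP.
  exact: (measurable_lyapunov f g xs gamma chi p omega (locodl_step_measurable
    (measurableT_comp (@theta_past_coin t) measurable_fst) measurable_snd
    (state_measurable_comp measurable_fst mS))).
- by move=> z; rewrite lee_fin; exact: lyapunov_ge0.
- apply/measurable_EFinP.
  exact: (measurable_step_bound xs f_smooth g_smooth gamma chi p omega (@theta_past_coin t) mS).
- move=> w1; rewrite /K /M /=; case: (theta t w1).
    exact: expected_compressor_step_le.
  under eq_integral do rewrite /Psi lyapunov_step_false.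
  by rewrite (integral_cst _ measurableT)/= probability_setT mule1.
Qed.

(** The coin of iteration t is independent of the past, which is frozen. *)
Lemma expected_Psi_coin t :
  (\int[P]_w (step_bound f g xs gamma chi p omega (theta t w) (S t w))%:E <=
   \int[P]_w (tau * Psi (S t w))%:E)%E.
Proof.
pose K (z : g_sigma_algebraType (past t) * g_sigma_algebraType (sigma_rv (theta t))) : \bar R :=
  (step_bound f g xs gamma chi p omega (theta t z.2) (S t z.1))%:E.
pose M (w : g_sigma_algebraType (past t)) : \bar R := (tau * Psi (S t w))%:E.
apply: (integral_diag_indep_le (joint_sigma_sub source_sigma _) (source_sigma (inr t))
  (@indep_past_coin t) (K := K) (M := M)).
- apply/measurable_EFinP.
  exact: (measurable_step_bound xs f_smooth g_smooth gamma chi p omega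
    (measurableT_comp (@preimage_set_system_measurable_fun _ _ _ setT (theta t)) measurable_snd)
    (state_measurable_comp measurable_fst (iterate_measurable t))).
- by move=> z; rewrite lee_fin; exact: step_bound_ge0.
- apply/measurable_EFinP; apply: measurable_funM => //.
  exact: (measurable_lyapunov f g xs gamma chi p omega (iterate_measurable t)).
- move=> w1; rewrite /K /M /=.
  rewrite (integral_coin (h := fun b => step_bound f g xs gamma chi p omega b (S t w1))
    (theta_meas t) (theta_prob t)).
    by rewrite lee_fin; apply: coin_average_le => //; exact: dual_sum_locodl.
  by move=> b; exact: step_bound_ge0.
Qed.

Lemma expected_Psi_le t : (\int[P]_w (Psi (S t w))%:E <= (tau ^+ t * Psi s0)%:E)%E.
Proof.
elim: t => [|t IH].
  have -> : (\int[P]_w (Psi (S 0 w))%:E = \int[P]_w cst (Psi s0)%:E w)%E by [].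
  by rewrite expr0 mul1r integral_cst//= probability_setT mule1.
apply: le_trans (expected_Psi_compressor t) _.
apply: le_trans (expected_Psi_coin t) _.
under eq_integral do rewrite EFinM.
rewrite ge0_integralZl_EFin//; first last.
- exact: tau_ge0.
- by apply/measurable_EFinP; exact: Psi_measurable.
- by move=> w _; rewrite lee_fin; exact: lyapunov_ge0.
by rewrite exprS -mulrA EFinM lee_wpmul2l// lee_fin tau_ge0.
Qed.

End convergence.

(** * Almost sure convergence *)

Section almost_sure.
Context {R : realType} {disp : measure_display} {Omega : measurableType disp}.
Variable P : probability Omega R.

Lemma nneseries_geometric_lty (q a : R) : 0 <= q -> q < 1 -> 0 <= a ->
  (\sum_(k <oo) (q ^+ k * a)%:E < +oo)%E.
Proof.
move=> q0 q1 a0; apply: (@le_lt_trans _ _ (a / (1 - q))%:E); last exact: ltry.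
apply: lime_le.
  by apply: is_cvg_nneseries => k _ _; rewrite lee_fin mulr_ge0// exprn_ge0.
apply: nearW => N; rewrite sumEFin lee_fin.
under eq_bigr do rewrite mulrC.
have := congr1 (fun u => u N) (@geometric_seriesE R a q (negbT (lt_eqF q1))).
rewrite /series /geometric /= => ->.
apply: ler_wpM2r; first by rewrite invr_ge0 subr_ge0 ltW.
by rewrite ler_piMr// gerBl exprn_ge0.
Qed.

(** The series of the Z t has finite expectation, so it converges almost surely. *)
Lemma ae_cvg0_geometric (Z : nat -> Omega -> R) (q a : R) :
  0 <= q -> q < 1 -> 0 <= a ->
  (forall t, measurable_fun setT (Z t)) -> (forall t w, 0 <= Z t w) ->
  (forall t, \int[P]_w (Z t w)%:E <= (q ^+ t * a)%:E)%E ->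
  {ae P, forall w, Z t w @[t --> \oo] --> 0}.
Proof.
move=> q0 q1 a0 mZ Z0 Zq.
pose F w := (\sum_(k <oo) (Z k w)%:E)%E.
have mEZ t : measurable_fun setT (fun w => (Z t w)%:E) by exact/measurable_EFinP.
have F0 w : (0 <= F w)%E by apply: nneseries_ge0 => k _ _; rewrite lee_fin.
have mF : measurable_fun setT F by apply: ge0_emeasurable_sum => // k w _ _; rewrite lee_fin.
have iF : P.-integrable setT F.
  apply/integrableP; split=> //.
  under eq_integral do rewrite gee0_abs//.
  rewrite integral_nneseries//; last by move=> k w _; rewrite lee_fin.
  apply: le_lt_trans (nneseries_geometric_lty q0 q1 a0).
  by apply: lee_nneseries => // k _ _; apply: integral_ge0 => w _; rewrite lee_fin.
apply: filterS (integrable_ae measurableT iF) => w /(_ I) Fw.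
apply: cvg_series_cvg_0; apply: nnseries_is_cvg => //.
by rewrite ltey_eq -/(F w) Fw.
Qed.

Lemma cvg_rV_of_sqr d (x : nat -> 'rV[R]_d) (l : 'rV[R]_d) (K : R) (psi : nat -> R) :
  (forall t, dot (x t - l) (x t - l) <= K * psi t) -> psi @ \oo --> 0 ->
  x @ \oo --> l.
Proof.
move=> xpsi psi0; apply/cvgrPdist_lt => e e0.
have Kpsi : K * psi t @[t --> \oo] --> 0.
  by rewrite -[X in _ --> X](mulr0 K); apply: cvgMl_tmp.
have e2 : 0 < e ^+ 2 by rewrite exprn_gt0.
near=> t.
rewrite distrC; apply: le_lt_trans (norm_le_enorm _) _.
rewrite -ltr_sqr ?nnegrE ?enorm_ge0 ?(ltW e0)// sqr_enorm.
apply: le_lt_trans (xpsi t) _; apply: le_lt_trans (ler_norm _) _.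
by near: t; exact: cvgr0_norm_lt Kpsi _ e2.
Unshelve. all: by end_near. Qed.
End almost_sure.

Section lyapunov_lb.
Context {R : realType} {d n : nat}.
Hypothesis n_gt0 : (0 < n)%N.
Variables (f : 'I_n -> 'rV[R]_d -> R) (g : 'rV[R]_d -> R) (xs : 'rV[R]_d).
Variables (gamma chi p omega : R).
Hypotheses (gamma_gt0 : 0 < gamma) (chi_gt0 : 0 < chi) (p_gt0 : 0 < p)
  (omega_ge0 : 0 <= omega).

Lemma sqr_le_weighted_sum (x : 'I_n -> 'rV[R]_d) (y : 'rV[R]_d) :
  (forall i, dot (x i) (x i) <= \sum_i dot (x i) (x i) + n%:R * dot y y) /\
  dot y y <= \sum_i dot (x i) (x i) + n%:R * dot y y.
Proof.
have ny : dot y y <= n%:R * dot y y.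
  by rewrite ler_peMl ?dot_ge0// ler1n.
split=> [i|].
  rewrite (bigD1 i)//= -addrA lerDl addr_ge0//; last by rewrite (le_trans (dot_ge0 y)).
  by apply: sumr_ge0 => k _; exact: dot_ge0.
apply: le_trans ny _; rewrite lerDr; apply: sumr_ge0 => k _; exact: dot_ge0.
Qed.

Lemma sqr_errors_le_lyapunov :
  exists K : R, forall s : state R d n,
  let Psi := lyapunov f g gamma chi p omega xs s in
  [/\ forall i, dot (st_x s i - xs) (st_x s i - xs) <= K * Psi,
      dot (st_y s - xs) (st_y s - xs) <= K * Psi,
      forall i, dot (uerr f xs s i) (uerr f xs s i) <= K * Psi &
      dot (verr g xs s) (verr g xs s) <= K * Psi].
Proof.
pose c := gamma * (1 + 2 * omega) / (p ^+ 2 * chi).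
have om0 : 0 < 1 + 2 * omega by have := omega_ge0; lra.
have c0 : 0 < c by rewrite divr_gt0 ?mulr_gt0 ?exprn_gt0.
(* gamma and c^-1 invert the weights of the primal and of the dual part. *)
exists (gamma + c^-1) => s Psi.
have [hx hy] := sqr_le_weighted_sum (fun i => st_x s i - xs) (st_y s - xs).
have [hu hv] := sqr_le_weighted_sum (uerr f xs s) (verr g xs s).
set A := (X in _ <= X) in hy; set B := (X in _ <= X) in hv.
have A0 : 0 <= A by apply: le_trans hy; exact: dot_ge0.
have B0 : 0 <= B by apply: le_trans hv; exact: dot_ge0.
have PsiE : Psi = gamma^-1 * A + c * B by rewrite /Psi lyapunov_dot.
have ci0 : 0 < c^-1 by rewrite invr_gt0.
have gi0 : 0 < gamma^-1 by rewrite invr_gt0.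
have KPsi : (gamma + c^-1) * Psi = A + B + (gamma * c * B + c^-1 * gamma^-1 * A).
  by rewrite PsiE; field; rewrite !gt_eqF.
have r0 : 0 <= gamma * c * B + c^-1 * gamma^-1 * A 
  by apply: addr_ge0; rewrite mulr_ge0// mulr_ge0// ltW.
have AK : A <= (gamma + c^-1) * Psi by rewrite KPsi -addrA lerDl addr_ge0.
have BK : B <= (gamma + c^-1) * Psi by rewrite KPsi (addrC A) -addrA lerDl addr_ge0.
split.
- by move=> i; exact: le_trans (hx i) AK.
- exact: le_trans hy AK.
- by move=> i; exact: le_trans (hu i) BK.
- exact: le_trans hv BK.
Qed.

Lemma contraction_factor_lt1 (mu L : R) : 0 < mu -> mu <= L -> gamma < 2 / L ->
  Num.max (Num.max ((1 - gamma * mu) ^+ 2) ((1 - gamma * L) ^+ 2))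
          (1 - p ^+ 2 * chi / (1 + 2 * omega)) < 1.
Proof.
move=> mu0 muL gL.
have L0 : 0 < L by exact: lt_le_trans muL.
have gL2 : gamma * L < 2 by rewrite -ltr_pdivlMr.
have gm2 : gamma * mu < 2 by apply: le_lt_trans gL2; rewrite ler_pM2l.
have sq a : 0 < a -> a < 2 -> (1 - a) ^+ 2 < 1.
  move=> a0 a2; have : 0 < a * (2 - a) by rewrite mulr_gt0// subr_gt0.
  by rewrite -subr_gt0 => h; rewrite -subr_gt0; move: h; congr (_ < _); ring.
rewrite !gt_max !sq ?mulr_gt0//= gtrBl divr_gt0 ?mulr_gt0 ?exprn_gt0//.
by have := omega_ge0; lra.
Qed.

End lyapunov_lb.

Theorem theorem3p1 (R : realType) (d n : nat) (hd : (0 < d)%N) (hn : (0 < n)%N)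
    (mu L : R) (hmu : 0 < mu) (hmuL : mu <= L)
    (f : 'I_n -> 'rV[R]_d -> R) (g : 'rV[R]_d -> R)
    (f_smooth : forall i, smooth L (f i)) (g_smooth : smooth L g)
    (f_cvx : forall i, strongly_convex mu (f i)) (g_cvx : strongly_convex mu g)
    (xs : 'rV[R]_d)
    (xs_min : unique_minimizer
       (fun x => n%:R^-1 * (\sum_(i < n) f i x) + g x) xs)
    (gamma chi rho p omega omega_av : R)
    (gamma_gt0 : 0 < gamma) (chi_gt0 : 0 < chi) (rho_gt0 : 0 < rho)
    (p_gt0 : 0 < p) (p_le1 : p <= 1)
    (omega_ge0 : 0 <= omega) (omega_av_ge0 : 0 <= omega_av)
    (disp : measure_display) (Omega : measurableType disp)
    (P : probability Omega R)
    (* [G t] carries the joint randomness of the [n] compressors at time [t] *)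
    (G : nat -> set (set Omega))
    (C : 'I_n -> nat -> Omega -> 'rV[R]_d -> 'rV[R]_d)
    (theta : nat -> Omega -> bool)
    (G_sigma : forall t, is_sub_sigma_algebra (G t))
    (C_random : forall i t, random_operator (G t) (C i t))
    (theta_meas : forall t, measurable_fun setT (theta t))
    (theta_prob : forall t, P (theta t @^-1` [set true]) = p%:E)
    (indep : mutually_independent P
       (fun k : nat + nat =>
          match k with inl t => G t | inr t => sigma_rv (theta t) end))
    (C_unbiased : forall i t, unbiased_compressor P omega (C i t))
    (C_av : forall (t : nat) (x : 'I_n -> 'rV[R]_d),
       ('E_P[fun w => (enorm (n%:R^-1 *: \sum_(i < n) (C i t w (x i) - x i)) ^+ 2)%R]
          <= (omega_av / n%:R * \sum_(i < n) enorm (x i) ^+ 2)%:E)%E)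
    (gamma_lt : gamma < 2 / L)
    (rho_chi : 0 <= 2 * rho - rho ^+ 2 * (1 + omega_av) - chi)
    (s0 : state R d n)
    (s0_sum : n%:R^-1 *: (\sum_(i < n) st_u s0 i) + st_v s0 = 0) :
  let S := locodl f g gamma chi rho p omega C theta s0 in
  let Psi := lyapunov f g gamma chi p omega xs in
  let tau := Num.max (Num.max ((1 - gamma * mu) ^+ 2) ((1 - gamma * L) ^+ 2))
                     (1 - p ^+ 2 * chi / (1 + 2 * omega)) in
  [/\ tau < 1,
      forall t, ('E_P[fun w => Psi (S t w)] <= (tau ^+ t * Psi s0)%:E)%E &
      {ae P, forall w,
        [/\ forall i, (fun t => st_x (S t w) i) @ \oo --> xs,
            (fun t => st_y (S t w)) @ \oo --> xs,
            forall i, (fun t => st_u (S t w) i) @ \oo --> grad (f i) xs &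
            (fun t => st_v (S t w)) @ \oo --> grad g xs]}].
Proof.
move=> S Psi tau.
have L_gt0 : 0 < L by exact: lt_le_trans hmuL.
have n0 : n%:R != 0 :> R by rewrite pnatr_eq0 -lt0n.
have gradx := mean_gradient_minimizer L_gt0 f_smooth g_smooth hn xs_min.1.
have s0_sum' : \sum_i st_u s0 i + n%:R *: st_v s0 = 0.
  by move/(congr1 ( *:%R n%:R)): s0_sum; rewrite scalerDr scalerA divff// scale1r scaler0.
have tau_lt1 : tau < 1 by exact: contraction_factor_lt1.
have EPsi t := expected_Psi_le hn hmuL f_smooth g_smooth f_cvx g_cvx gradx gamma_gt0 chi_gt0
  p_gt0 omega_ge0 omega_av_ge0 G_sigma C_random theta_meas theta_prob indep C_unbiased C_av
  rho_chi s0_sum' t.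
split=> //; first by move=> t; rewrite unlock; exact: EPsi.
have Psi_cvg0 : {ae P, forall w, Psi (S t w) @[t --> \oo] --> 0}.
  have tau_ge0 : 0 <= tau by rewrite /tau !le_max sqr_ge0.
  apply: (ae_cvg0_geometric tau_ge0 tau_lt1
    (lyapunov_ge0 _ _ _ gamma_gt0 chi_gt0 p_gt0 omega_ge0 s0) _ _ EPsi).
  - move=> t; exact: (Psi_measurable f_smooth g_smooth xs _ _ _ _ _ G_sigma
      C_random theta_meas s0 t).
  - by move=> t w; exact: lyapunov_ge0.
have [K HK] := sqr_errors_le_lyapunov hn f g xs gamma_gt0 chi_gt0 p_gt0 omega_ge0.
apply: filterS Psi_cvg0 => w Psi0; split.
- by move=> i; apply: (cvg_rV_of_sqr _ Psi0) => t; have [h _ _ _] := HK (S t w); exact: h.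
- by apply: (cvg_rV_of_sqr _ Psi0) => t; have [_ h _ _] := HK (S t w); exact: h.
- by move=> i; apply: (cvg_rV_of_sqr _ Psi0) => t; have [_ _ h _] := HK (S t w); exact: h.
- by apply: (cvg_rV_of_sqr _ Psi0) => t; have [_ _ _ h] := HK (S t w); exact: h.
Qed.
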